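(* Let $\mathcal{A},\mathcal{B}\subsetneq \mathbb{Z}_M^2$ be alphabets, with Cantor iterates $\mathcal{X}_k,\mathcal{Y}_k\subset\mathbb{Z}_{M^k}^2$ and limiting Cantor sets $\mathbf{X},\mathbf{Y}\subset\mathbb{T}^2$ respectively. Then either there exist $\mathbf{v}=(a,b)\in\mathbb{R}^2\setminus\{0\}$ and $\mathbf{p},\mathbf{q}\in\mathbb{T}^2$ such that $$\mathbb{R}\mathbf{v}+\mathbf{p}\subset\mathbf{X}\quad\text{and}\quad \mathbb{R}\mathbf{v}^{\perp}+\mathbf{q}\subset\mathbf{Y},$$ or, if not, there exist $\beta>0$ and $C>0$ such that for all $k\ge 1$ $$\|1_{\mathcal{Y}_k}\,\mathcal{F}\,1_{\mathcal{X}_k}\|_{2\to2}\le C M^{-k\beta}.$$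
   Context: $M$ is a positive integer (the base), $\mathbb{Z}_N=\mathbb{Z}/N\mathbb{Z}$. An alphabet is a proper subset $\mathcal{A}\subsetneq\mathbb{Z}_M^2$, with $\mathbb{Z}_M$ identified with $\{0,\dots,M-1\}$. Its $k$-th Cantor iterate is $$\mathcal{X}_k=\Big\{\Big(\sum_{j=0}^{k-1}a_jM^j,\ \sum_{j=0}^{k-1}b_jM^j\Big):(a_j,b_j)\in\mathcal{A}\text{ for all }j\Big\}\subset\mathbb{Z}_N^2,\qquad N=M^k,$$ and $\mathcal{Y}_k$ is defined in the same way from $\mathcal{B}$. $\mathbb{T}^2=\mathbb{R}^2/\mathbb{Z}^2$, identified as a set with $[0,1)^2$. The limiting Cantor set of $\mathcal{A}$ is $\mathbf{X}=\bigcap_{k\ge1}\mathbf{X}_k$, where $\mathbf{X}_k$ is the closure in $\mathbb{T}^2$ of $\{(x,y)\in[0,1)^2:(\lfloor M^kx\rfloor,\lfloor M^ky\rfloor)\in\mathcal{X}_k\}$. Equivalently, $\mathbf{X}$ is the set of points $(x,y)\in\mathbb{T}^2$ having some base-$M$ expansions $x=0.a_0a_1\dots$, $y=0.b_0b_1\dots$ with $(a_j,b_j)\in\mathcal{A}$ for all $j\ge0$ (if a coordinate has two expansions, either may be used). $\mathbf{Y}$ is defined in the same way from $\mathcal{B}$. For $\mathbf{v}=(a,b)\in\mathbb{R}^2$, $\mathbf{v}^\perp=(-b,a)$; $\mathbb{R}\mathbf{v}+\mathbf{p}\subset\mathbb{T}^2$ denotes $\{t\mathbf{v}+\mathbf{p}\bmod\mathbb{Z}^2:t\in\mathbb{R}\}$.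 $\mathcal{F}$ is the unitary discrete Fourier transform on $\ell^2(\mathbb{Z}_N^2)$: $\mathcal{F}f(\boldsymbol\xi)=\frac1N\sum_{\mathbf{x}\in\mathbb{Z}_N^2}f(\mathbf{x})e^{-\frac{2\pi i}{N}\mathbf{x}\cdot\boldsymbol\xi}$. For a set $S$, $1_S$ denotes multiplication by the indicator function of $S$, and $\|\cdot\|_{2\to2}$ is the operator norm on $\ell^2(\mathbb{Z}_N^2)$. *)

(* Defs.v *)
From mathcomp Require Import all_boot all_order all_algebra.
From mathcomp Require Import all_classical all_reals all_analysis.
From mathcomp Require Export complex.

Set Implicit Arguments.
Unset Strict Implicit.
Unset Printing Implicit Defensive.

Import Order.TTheory GRing.Theory Num.Theory.
Import numFieldNormedType.Exports.

Local Open Scope ring_scope.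

(* 'I_N, i.e. {0, ..., N-1}, serves as the underlying set of Z_N: the ring
   structure is never needed, since x . xi only matters modulo N in the
   character e^{-2 i pi (x . xi) / N}. *)
Notation grid N := ('I_N * 'I_N)%type.

Definition cantor_iterate (M : nat) (A : {set grid M}) (k : nat) :
    {set grid (M ^ k)} :=
  finset (fun x : grid (M ^ k) =>
    [exists d : {ffun 'I_k -> grid M},
      [&& [forall j, d j \in A],
          (x.1 == \sum_(j < k) (d j).1 * M ^ j :> nat)%N
        & (x.2 == \sum_(j < k) (d j).2 * M ^ j :> nat)%N]]).

Section Torus.
Variable R : realType.

Definition torus_eq (p q : R * R) : bool :=
  (p.1 - q.1 \is a Num.int) && (p.2 - q.2 \is a Num.int).

Lemma torus_eq_refl : reflexive torus_eq.
Proof. by move=> p; rewrite /torus_eq !subrr rpred0. Qed.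

Lemma torus_eq_sym : symmetric torus_eq.
Proof.
by move=> p q; rewrite /torus_eq -(opprB q.1) -(opprB q.2) !rpredN.
Qed.

Lemma torus_eq_trans : transitive torus_eq.
Proof.
move=> q p r /andP[pq1 pq2] /andP[qr1 qr2]; apply/andP; split.
- by rewrite -[p.1](subrK q.1) -addrA rpredD.
- by rewrite -[p.2](subrK q.2) -addrA rpredD.
Qed.

Canonical torus_equiv :=
  EquivRel torus_eq torus_eq_refl torus_eq_sym torus_eq_trans.

Definition torus : topologicalType :=
  quotient_topology {eq_quot torus_equiv}%qT.

Definition torus_pi (p : R * R) : torus := (\pi_{eq_quot torus_equiv} p)%qT.

Definition torus_repr (p : torus) : R * R :=
  repr (p : {eq_quot torus_equiv}%qT).

Local Open Scope classical_set_scope.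

Definition cantor_approx (M : nat) (A : {set grid M}) (k : nat) : set torus :=
  closure (torus_pi @` [set p : R * R |
    [/\ 0 <= p.1 < 1, 0 <= p.2 < 1 &
      exists2 d : grid (M ^ k), d \in cantor_iterate A k &
        Num.floor ((M ^ k)%:R * p.1) = d.1%:Z /\
        Num.floor ((M ^ k)%:R * p.2) = d.2%:Z]]).

Definition limit_cantor_set (M : nat) (A : {set grid M}) : set torus :=
  \bigcap_(k in [set k : nat | (1 <= k)%N]) cantor_approx A k.

Definition perp (v : R * R) : R * R := (- v.2, v.1).

(* Independent of the representative of p, as torus_pi is Z^2-periodic. *)
Definition torus_line (v : R * R) (p : torus) : set torus :=
  range (fun t : R =>
    torus_pi (t * v.1 + (torus_repr p).1, t * v.2 + (torus_repr p).2)).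

End Torus.

Section Fourier.
Variable R : realType.

(* e^{i t} *)
Definition expi (t : R) : R[i] := Complex (cos t) (sin t).

Definition dft (N : nat) (f : {ffun grid N -> R[i]}) : {ffun grid N -> R[i]} :=
  [ffun xi : grid N => (N%:R)^-1 * \sum_(x : grid N)
     f x * expi (- (2 * pi / N%:R * (x.1 * xi.1 + x.2 * xi.2)%N%:R))].

Definition indic_mul (T : finType) (S : {set T}) (f : {ffun T -> R[i]}) :
    {ffun T -> R[i]} :=
  [ffun x => if x \in S then f x else 0].

Definition l2norm (T : finType) (f : {ffun T -> R[i]}) : R :=
  Num.sqrt (\sum_(x : T) ComplexField.Normc.normc (f x) ^+ 2).

Local Open Scope classical_set_scope.

(* The set is nonempty and, for linear L, bounded, so that sup is not junk. *)
Definition opnorm (T : finType) (L : {ffun T -> R[i]} -> {ffun T -> R[i]}) : R :=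
  sup [set l2norm (L f) | f in [set f | l2norm f <= 1]].

End Fourier.

(* Main.v *)
Require Import Defs.
From mathcomp Require Import all_boot all_order all_algebra all_field.
From mathcomp Require Import all_classical all_reals all_analysis.
From mathcomp Require Import zify ring lra.

(** Write N = M^k. The Fourier transform on Z_(M^(k+l)) is a transform on
    Z_(M^l), a multiplication by a phase and a transform on Z_(M^k), and Cantor
    iterates split accordingly. So the norms are submultiplicative in k
    ([energy_bound_add]) and decay exponentially as soon as one of them is
    below 1 ([exponential_decay]). The norm at step k is below 1 unless there
    is an extremizer: a nonzero function supported in X_k whose transform is
    supported in Y_k ([spectral_gap]). The existence of an extremizer is a rank
    condition on a matrix of powers of a primitive N-th root of unity, so it
    does not depend on the field: extremizers may be taken with algebraic
    values, where the root of unity z has Galois conjugates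
    ([row_free_exp_transfer]). What remains is to find the two lines when there
    are extremizers for every k.

    A grid point x is seen as the point (z^x1, z^x2) of the plane, so that the
    Fourier coefficients of f are its pairings with monomials. As B misses a
    digit, a modulation of an extremizer f is orthogonal to all polynomials of
    bidegree less than M^(k-1) ([modulated_vanishing_moments]). As A misses a
    digit, |X_k| <= |A|^k is so small that a nonzero polynomial of bidegree
    d = o(N / k) vanishes on X_k ([annihilator_exists], [degree_parameter]).
    After multiplying f by a polynomial of bidegree at most d, it is
    annihilated by an irreducible polynomial Q ([minimal_annihilator]). A
    function that is orthogonal to polynomials of low degree and is annihilated
    by two coprime polynomials vanishes ([annihilated_by_coprime]). Hence f may
    be multiplied by any nonzero polynomial of no larger degrees than Q that is
    not a multiple of Q without being killed ([irred_annihilator_unique]).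

    The arithmetic step uses that last fact for Galois conjugates of Q. The
    automorphism z -> z^(1+n) with n = M^(k-j-1) turns Q, for each x in the
    support of f, into a polynomial T_x that vanishes at x. Suppose that
    (x - y).(u - v) is divisible by M^j for all x, y in the support and all
    exponents u, v of monomials of Q. Then there are at most M^2 polynomials T_x
    up to scalars, and multiplying by those which are not multiples of Q leaves
    only points x with T_x proportional to Q. Comparing coefficients improves
    the divisibility to M^(j+1) ([level_step]). At j = k-1 ([all_levels]) one
    more multiplication concentrates f on one line x.(a,b) = c mod N, where the
    coprime pair (a,b) is the direction of a difference of two exponents of Q
    ([separate_lines]). All these multiplications have total bidegree D = o(N).

    A nonzero function on a line which is orthogonal to polynomials of low
    degree has many points in its support, and its transform has constant
    modulus along the direction (a,b), hence is nonzero on a whole line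
    ([line_structure]). So |a|, |b| < 2M, the set X_k has at least M^(k-1)/2
    points on a line, and every point of some line of direction (a,b) is within
    D of Y_k ([extremizer_line_structure]).

    The same (a,b) occurs for infinitely many k. If every line at some level j
    missed a point of X_j, self-similarity would make the points of X_k on a
    line exponentially fewer than N ([card_cantor_line]); so every X_j contains
    a whole line ([populous_lines_full]). Finally discrete lines, even if known
    only up to an error o(N), converge to a line in the limiting Cantor set
    ([limit_line]): of direction (b,-a) for A and (a,b) for B. *)

Set Implicit Arguments.
Unset Strict Implicit.
Unset Printing Implicit Defensive.

Import Order.TTheory GRing.Theory Num.Theory.
Import numFieldNormedType.Exports.

Local Open Scope ring_scope.

(** * Division by a lattice of polynomial vectors *)

Section RowReduction.
Variable F : fieldType.

(** This is long division: since the matrix of the coefficients of degree h i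
    of the rows is invertible, the top coefficients of p can be cancelled by a
    combination of shifted rows. *)
Lemma poly_lattice_div_lead n (A : 'M[{poly F}]_n) (h : 'I_n -> nat) d :
  (forall i j, (size (A i j) <= (h i).+1)%N) -> (forall i, (h i <= d)%N) ->
  \matrix_(i, j) (A i j)`_(h i) \in unitmx ->
  forall p : 'rV[{poly F}]_n, exists q : 'rV_n,
    forall j, (size ((p - q *m A)%R ord0 j) <= d)%N.
Proof.
move=> sA hd unitL p; set L := \matrix_(i, j) _ in unitL.
have [e] : exists e, forall j, (size (p ord0 j) <= e)%N.
  exists (\max_j size (p ord0 j)) => j.
  by rewrite (leq_bigmax j).
elim: e p => [|e IHe] p sp.
  exists 0 => j; rewrite mul0mx subr0.
  by apply: leq_trans (sp j) _.
have [led|lted] := leqP e.+1 d.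
  exists 0 => j; rewrite mul0mx subr0.
  by apply: leq_trans (sp j) _.
pose c := \row_j (p 0 j)`_e; pose r := c *m invmx L.
pose q0 : 'rV[{poly F}]_n := \row_i (r 0 i *: 'X^(e - h i)).
have [j|q qP] := IHe (p - q0 *m A); last first.
  exists (q0 + q) => j; have := qP j.
  by rewrite mulmxDl opprD addrA.
apply/leq_sizeP => m lem; rewrite !mxE coefB coef_sum.
under eq_bigr => i _ do rewrite !mxE -scalerAl coefZ coefXnM.
have [->|ne] := eqVneq m e.
  apply/eqP; rewrite subr_eq0; apply/eqP.
  transitivity ((r *m L) 0 j); first by rewrite mulmxKV // mxE.
  rewrite mxE; apply: eq_bigr => i _; rewrite [L i j]mxE.
  have hi := hd i; rewrite ifF; last by lia.
  by rewrite [r 0 i]mxE subKn //; lia.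
have lt_em : (e < m)%N by rewrite ltn_neqAle eq_sym ne.
rewrite big1 ?subr0; last first.
  move=> i _; have hi := hd i; case: ifP => _; first by rewrite mulr0.
  rewrite nth_default ?mulr0 //; apply: leq_trans (sA i j) _; lia.
by rewrite nth_default //; apply: leq_trans (sp j) _.
Qed.

(** If the matrix L of leading coefficients is singular, a relation between its
    rows allows to replace, among the rows involved, one of largest degree by a
    combination of smaller degree; the rows stay independent and the sum of the
    row degrees drops, until [poly_lattice_div_lead] applies. *)
Lemma poly_lattice_div n (A : 'M[{poly F}]_n) d :
  (forall q : 'rV_n, q *m A = 0 -> q = 0) ->
  (forall i j, (size (A i j) <= d.+1)%N) ->
  forall p : 'rV[{poly F}]_n, exists q : 'rV_n,
    forall j, (size ((p - q *m A)%R ord0 j) <= d)%N.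
Proof.
move=> freeA sA.
have [h sh hd] : exists2 h : 'I_n -> nat,
    forall i j, (size (A i j) <= (h i).+1)%N & forall i, (h i <= d)%N.
  by exists (fun=> d).
have [s] := ubnP (\sum_i h i)%N; elim: s => // s IHs in A freeA {sA} h sh hd *.
move=> ss p; set L := \matrix_(i, j) (A i j)`_(h i).
have [unitL|] := boolP (L \in unitmx); first exact: (poly_lattice_div_lead sh).
rewrite -row_free_unit -kermx_eq0 => /rowV0Pn[c /sub_kermxP cL c0].
have [i1 ci1] : exists i, c 0 i != 0.
  apply/existsP; apply: contraNT c0 => /existsPn c0; apply/eqP/rowP => i.
  by rewrite [RHS]mxE; apply/eqP; rewrite -[_ == _]negbK; apply: c0.
have [i0 ci0 i0max] : exists2 i0, c 0 i0 != 0 &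
    forall i, c 0 i != 0 -> (h i <= h i0)%N.
  by case: (@arg_maxnP _ i1 (fun i => c 0 i != 0) h ci1) => i0; exists i0.
(* E replaces row i0 by the relation c, its terms shifted to degree h i0 *)
pose E : 'M[{poly F}]_n := \matrix_(i, j)
  if i == i0 then c 0 j *: 'X^(h i0 - h j) else (i == j)%:R.
have rowEA i j : i != i0 -> (E *m A) i j = A i j.
  move=> ni; rewrite mxE (bigD1 i) //= mxE (negPf ni) eqxx mul1r big1 ?addr0 //.
  by move=> k nk; rewrite mxE (negPf ni) eq_sym (negPf nk) mul0r.
have rowEA0 j : (size ((E *m A) i0 j) <= h i0)%N.
  apply/leq_sizeP => m lem; rewrite mxE coef_sum.
  under eq_bigr => i _ do rewrite mxE eqxx -scalerAl coefZ coefXnM.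
  have [->|ne] := eqVneq m (h i0).
    transitivity ((c *m L) 0 j); last by rewrite cL mxE.
    rewrite mxE; apply: eq_bigr => i _; rewrite [L i j]mxE.
    have [->|/i0max le] := eqVneq (c 0 i) 0; first by rewrite !mul0r.
    by rewrite ifF; [rewrite subKn | lia].
  rewrite big1 // => i _.
  have [->|/i0max le] := eqVneq (c 0 i) 0; first by rewrite mul0r.
  case: ifP => _; rewrite ?mulr0 //.
  by rewrite nth_default ?mulr0 //; apply: leq_trans (sh i j) _; lia.
have freeEA (q : 'rV_n) : q *m (E *m A) = 0 -> q = 0.
  rewrite mulmxA => /freeA/rowP qE.
  have q0 : q 0 i0 = 0.
    have /eqP := qE i0.
    rewrite !mxE (bigD1 i0) //= mxE eqxx subnn expr0 big1 ?addr0.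
      by rewrite mulf_eq0 scaler_eq0 oner_eq0 (negPf ci0) !orbF => /eqP.
    by move=> k nk; rewrite mxE (negPf nk) mulr0.
  apply/rowP => j; rewrite [RHS]mxE; have [-> //|nj] := eqVneq j i0.
  have := qE j; rewrite !mxE (bigD1 j) //= mxE (negPf nj) eqxx mulr1 big1 ?addr0 //.
  move=> k nk; rewrite mxE; have [->|_] := eqVneq k i0; rewrite ?q0 ?mul0r //.
  by rewrite (negPf nk) mulr0.
(* a row of degree 0 would be replaced by 0, against independence *)
have [h0|hpos] := posnP (h i0).
  suff /rowP/(_ i0) : delta_mx 0 i0 = 0 :> 'rV[{poly F}]_n.
    by rewrite !mxE !eqxx => /eqP; rewrite oner_eq0.
  apply: freeEA; rewrite -rowE; apply/rowP => j; rewrite !mxE.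
  by have := rowEA0 j; rewrite h0 leqn0 size_poly_eq0 mxE => /eqP.
have [| | |q qP] := IHs (E *m A) freeEA
    (fun i => if i == i0 then (h i).-1 else h i) _ _ _ p; last 1 first.
  by exists (q *m E) => j; rewrite -mulmxA.
- move=> i j; case: eqP => [->|/eqP ni]; last by rewrite rowEA.
  by rewrite prednK.
- move=> i; case: ifP => _ //; apply: leq_trans (hd i); exact: leq_pred.
- move: ss; rewrite (bigD1 i0) //= [in X in _ -> X](bigD1 i0) //= eqxx.
  under [in X in _ -> X]eq_bigr => i ni do rewrite (negPf ni).
  lia.
Qed.

End RowReduction.

(** * Functions annihilated by two coprime polynomials *)

Notation fibre z := (map_poly (horner_eval z)).

Section Coprime.
Variable F : fieldType.
Implicit Types P Q T U : {poly {poly F}}.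

Lemma horner2_fibre P x y : P.[x, y] = (fibre y P).[x].
Proof. by rewrite -horner2_swapXY horner_swapXY. Qed.

Lemma rVpoly_Sylvester Q T (q : 'rV_((size T).-1 + (size Q).-1)) :
  rVpoly (q *m Sylvester_mx Q T) =
    rVpoly (lsubmx q) * Q + rVpoly (rsubmx q) * T.
Proof.
rewrite -{1}[q]hsubmxK /Sylvester_mx mul_row_col !mul_rV_lin1 /= linearD /=.
have sM m (v : 'rV[{poly F}]_m) P : (size (rVpoly v * P)%R <= m + (size P).-1)%N.
  apply: leq_trans (size_polyMleq _ _) _.
  by case: (size P) => [|s]; rewrite ?addn0 ?addnS /= ?leq_add2r;
    first (apply: leq_trans (leq_pred _) _); apply: size_poly.
by rewrite !poly_rV_K // addnC.
Qed.

(** Here (a x, b x) is the point of the plane attached to x, the outer variable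
    being the first coordinate. The rows of the Sylvester matrix are multiples
    of Q and T, so f is orthogonal to them. Dividing by these rows lowers the
    degree in the second variable to at most d - 1 for all polynomials of degree
    less than n in the first; hence f is orthogonal to all of the latter,
    whatever their degree in the second variable. These are enough to isolate a
    point x0: a polynomial in the second variable selects the horizontal line of
    x0, and on this line f lives on the roots of the restriction of Q or T. *)
Lemma annihilated_by_coprime (X : finType) (a b f : X -> F) Q T d :
  (forall x y, a x = a y -> b x = b y -> x = y) ->
  resultant Q T != 0 ->
  (forall z, fibre z Q = 0 -> fibre z T <> 0) ->
  (forall x, f x * Q.[a x, b x] = 0) -> (forall x, f x * T.[a x, b x] = 0) ->
  (sizeY Q <= d.+1)%N -> (sizeY T <= d.+1)%N ->
  (forall P, (size P <= (size T).-1 + (size Q).-1)%N -> (sizeY P <= d)%N ->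
    \sum_x f x * P.[a x, b x] = 0) ->
  forall x, f x = 0.
Proof.
move=> inj res cop fQ fT sQ sT orth.
set n := ((size T).-1 + (size Q).-1)%N in orth.
pose phi P := \sum_x f x * P.[a x, b x].
have phiD P P' : phi (P + P') = phi P + phi P'.
  by rewrite /phi -big_split; apply: eq_bigr => x _; rewrite !hornerD mulrDr.
have phiM P P' : (forall x, f x * P'.[a x, b x] = 0) -> phi (P * P') = 0.
  move=> fP'; rewrite /phi big1 // => x _.
  by rewrite !hornerM mulrCA fP' mulr0.
have phi0 P : (size P <= n)%N -> phi P = 0.
  move=> sP.
  have [|i j|q qP] := @poly_lattice_div F n (Sylvester_mx Q T) d _ _ (poly_rV P).
  - move=> q qS; have := congr1 (mulmx q) (mul_mx_adj (Sylvester_mx Q T)).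
    rewrite mulmxA qS mul0mx mul_mx_scalar => /rowP q0; apply/rowP => i.
    have /esym/eqP := q0 i; rewrite !mxE mulf_eq0 => /orP[] /eqP // res0.
    by rewrite -/(resultant Q T) in res0; rewrite res0 eqxx in res.
  - rewrite Sylvester_mxE; case: (fintype.split i) => k; case: (k <= j)%N => /=;
      rewrite ?mulr1n ?mulr0n ?size_poly0 //;
      exact: leq_trans (max_size_coefXY _ _) _.
  rewrite -[P](poly_rV_K sP) -(subrK (q *m Sylvester_mx Q T) (poly_rV P)).
  rewrite linearD /= phiD rVpoly_Sylvester phiD !phiM // addr0 addr0.
  apply: orth; first exact: size_poly.
  apply/bigmax_leqP => i _; set r := poly_rV P - _ in qP *.
  rewrite coef_rVpoly; case: insubP => [j _ _|_]; last by rewrite size_poly0.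
  exact: qP.
move=> x0; apply/eqP/negPn/negP => fx0.
(* R is the restriction of Q, or else of T, to the horizontal line of x0 *)
have [R [R0 sR fR]] : exists R : {poly F}, [/\ R != 0, (size R <= n.+1)%N &
    forall x, b x = b x0 -> f x != 0 -> R.[a x] = 0].
  have fP P : (forall x, f x * P.[a x, b x] = 0) ->
      forall x, b x = b x0 -> f x != 0 -> (fibre (b x0) P).[a x] = 0.
    move=> fP x <- fx; rewrite -horner2_fibre.
    by have /eqP := fP x; rewrite mulf_eq0 (negPf fx) => /eqP.
  have [/cop/eqP T0|Q0] := eqVneq (fibre (b x0) Q) 0.
    exists (fibre (b x0) T); split=> //; last exact: fP.
    apply: leq_trans (size_poly _ _) _; apply: leq_trans (leqSpred _) _.
    by rewrite ltnS leq_addr.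
  exists (fibre (b x0) Q); split=> //; last exact: fP.
  apply: leq_trans (size_poly _ _) _; apply: leq_trans (leqSpred _) _.
  by rewrite ltnS leq_addl.
have [mu [h /implyP/(_ R0) h0 defR]] := multiplicity_XsubC R (a x0).
have mu_gt0 : (0 < mu)%N.
  case: mu defR => // defR; case/negP: h0.
  by rewrite -[h]mulr1 -defR rootE fR.
have sh : (size h <= n)%N.
  have h_neq0 : h != 0 by apply: contraNneq h0 => ->; rewrite root0.
  move: sR; rewrite defR size_mul ?size_exp_XsubC ?expf_neq0 ?polyXsubC_eq0 //.
  rewrite addnS /= -[(size h <= n)%N]ltnS; apply: leq_trans.
  by rewrite -addn1 leq_add2l.
(* p h is nonzero at x0 and vanishes at all other points of the support of f *)
pose p : {poly F} := \prod_(x | b x != b x0) ('X - (b x)%:P).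
have p_x0 : p.[b x0] != 0.
  rewrite horner_prod; apply/prodf_neq0 => x nx.
  by rewrite !hornerE subr_eq0 eq_sym.
have p_neq0 : p != 0 by apply: contraNneq p_x0 => ->; rewrite horner0.
have sP : (size (p%:P * map_poly polyC h)%R <= n)%N.
  rewrite mul_polyC; apply: leq_trans (size_scale_leq _ _) _.
  by apply: leq_trans (size_poly _ _) _.
have /eqP := phi0 _ sP; rewrite mul_polyC /phi (bigD1 x0) //= big1 ?addr0.
  rewrite hornerZ hornerM /= horner_map hornerC !mulf_eq0.
  by rewrite (negPf fx0) (negPf p_x0) -rootE (negPf h0).
move=> x nx; rewrite hornerZ hornerM /= horner_map hornerC.
have [bx|nbx] := eqVneq (b x) (b x0); last first.
  suff -> : p.[b x] = 0 by rewrite mul0r mulr0.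
  by rewrite /p (bigD1 x) //= hornerM hornerXsubC subrr mul0r.
have [->|fx] := eqVneq (f x) 0; first by rewrite mul0r.
have := fR _ bx fx; rewrite defR hornerM => /eqP; rewrite mulf_eq0.
case/orP=> [/eqP->|]; first by rewrite !mulr0.
rewrite horner_exp expf_eq0 mu_gt0 !hornerE subr_eq0 => /eqP ax.
by rewrite (inj x x0) ?eqxx in nx.
Qed.

End Coprime.

(** * Irreducible polynomials in two variables *)

Section Bidegree.
Variable F : idomainType.
Implicit Types P Q T U : {poly {poly F}}.

Definition bideg d P := (size P <= d.+1)%N && (sizeY P <= d.+1)%N.

Lemma bidegM d e P Q : bideg d P -> bideg e Q -> bideg (d + e) (P * Q).
Proof.
have sM (R : nzRingType) (p q : {poly R}) : (size p <= d.+1)%N ->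
    (size q <= e.+1)%N -> (size (p * q)%R <= (d + e).+1)%N.
  move=> sp sq; apply: leq_trans (size_polyMleq _ _) _.
  by move: (size p) (size q) sp sq => s t; lia.
rewrite /bideg !sizeYE rmorphM => /andP[sP sP'] /andP[sQ sQ'].
by rewrite !sM.
Qed.

Lemma bidegW d e P : (d <= e)%N -> bideg d P -> bideg e P.
Proof.
by move=> le_de /andP[s1 s2]; apply/andP; split; apply: leq_trans (_ : _ <= d.+1)%N _.
Qed.

Definition total_degree P := ((size P).-1 + (sizeY P).-1)%N.

Lemma predn_sizeM (R : idomainType) (p q : {poly R}) : p != 0 -> q != 0 ->
  (size (p * q)).-1 = ((size p).-1 + (size q).-1)%N.
Proof.
move=> p0 q0; rewrite size_mul //; rewrite -!size_poly_gt0 in p0 q0.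
by move: (size p) (size q) p0 q0 => s t; lia.
Qed.

Lemma predn_sizeYM P Q : P != 0 -> Q != 0 ->
  (sizeY (P * Q)).-1 = ((sizeY P).-1 + (sizeY Q).-1)%N.
Proof. by move=> P0 Q0; rewrite !sizeYE rmorphM predn_sizeM ?swapXY_eq0. Qed.

Lemma total_degreeM P Q : P != 0 -> Q != 0 ->
  total_degree (P * Q) = (total_degree P + total_degree Q)%N.
Proof.
by move=> P0 Q0; rewrite /total_degree predn_sizeM // predn_sizeYM // addnACA.
Qed.

Lemma sizeY_polyC (p : {poly F}) : sizeY p%:P = size p.
Proof.
by rewrite sizeYE swapXY_polyC size_map_inj_poly //; apply: polyC_inj.
Qed.

Lemma total_degree_eq0 P : P != 0 -> total_degree P = 0%N ->
  exists2 c, c != 0 & P = c%:P%:P.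
Proof.
move=> P0 /eqP; rewrite addn_eq0 => /andP[s1 s2].
have defP : P = (P`_0)%:P by apply: size1_polyC; case: (size P) s1 => [|[]].
rewrite {}defP polyC_eq0 sizeY_polyC in P0 s2 *; set p := P`_0 in P0 s2 *.
have defp : p = (p`_0)%:P by apply: size1_polyC; case: (size p) s2 => [|[]].
by exists p`_0; rewrite -?defp // -polyC_eq0 -defp.
Qed.

(** Factors of total degree 0 are the nonzero constants ([total_degree_eq0]).
    Nonzero constants are irreducible in this sense, which is harmless as they
    annihilate no nonzero function. *)
Definition irred Q := Q != 0 /\
  forall Q1 Q2, Q = Q1 * Q2 -> total_degree Q1 = 0%N \/ total_degree Q2 = 0%N.

End Bidegree.

Section Gauss.
Variable F : closedFieldType.
Implicit Types P Q T U : {poly {poly F}}.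

Lemma fibre_eq0 (z : F) P : fibre z P = 0 -> exists P1, P = ('X - z%:P)%:P * P1.
Proof.
move=> P0; exists (map_poly (fun p => p %/ ('X - z%:P)) P).
apply/polyP => i; rewrite coefCM coef_map_id0 ?div0p // mulrC divpK //.
by rewrite dvdp_XsubCl rootE -[_.[z]]/(horner_eval z P`_i) -coef_map P0 coef0.
Qed.

(** Gauss's lemma over an algebraically closed field: at each root z of c, one
    of G and H vanishes on the line where the second variable is z
    ([fibre_eq0]), and 'X - z is cancelled from it and from c. *)
Lemma gauss_descent (c : {poly F}) P G H : c != 0 -> c%:P * P = G * H ->
  exists g h G' H', [/\ G = g%:P * G', H = h%:P * H' & P = G' * H'].
Proof.
have [n] := ubnP (size c); elim: n => // n IHn in c G H *.
move=> sc c0 cP; have [/eqP/size_poly1P[u u0 defc]|] := eqVneq (size c) 1%N.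
  exists c, 1, (u^-1%:P%:P * G), H; split; last first.
  - by rewrite -mulrA -cP mulrA defc -!polyCM mulVf // mul1r.
  - by rewrite mul1r.
  - by rewrite mulrA defc -!polyCM mulfV // mul1r.
move=> /closed_rootP[z]; rewrite -dvdp_XsubCl => /dvdpP[c1 defc].
have c1_0 : c1 != 0 by apply: contraNneq c0; rewrite defc => ->; rewrite mul0r.
have Xz0 : ('X - z%:P)%:P != 0 :> {poly {poly F}} by rewrite polyC_eq0 polyXsubC_eq0.
have sc1 : (size c1 < n)%N.
  by move: sc; rewrite defc size_mul ?polyXsubC_eq0 // size_XsubC addn2.
have /eqP : fibre z G * fibre z H = 0.
  rewrite -rmorphM -cP rmorphM /= map_polyC /= /horner_eval defc.
  by rewrite hornerM hornerXsubC subrr mulr0 mul0r.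
rewrite mulf_eq0 => /orP[] /eqP/fibre_eq0[K defK].
- have [|g [h [G' [H' [defG defH defP]]]]] := IHn c1 K H sc1 c1_0.
    apply: (mulfI Xz0); rewrite mulrA -polyCM mulrC -[in LHS](mulrC c1) -defc.
    by rewrite mulrC cP defK mulrA.
  exists (('X - z%:P) * g), h, G', H'; split=> //.
  by rewrite defK defG mulrA polyCM.
- have [|g [h [G' [H' [defG defH defP]]]]] := IHn c1 G K sc1 c1_0.
    apply: (mulfI Xz0); rewrite mulrA -polyCM -(mulrC c1) -defc.
    by rewrite cP defK mulrCA.
  exists g, (('X - z%:P) * h), G', H'; split=> //.
  by rewrite defK defH mulrA polyCM.
Qed.

(** If the resultant were zero, a common factor of positive degree over the
    fraction field would descend by [gauss_descent] to one over the polynomial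
    ring. By irreducibility Q would divide T up to a constant, and then T would
    be a constant multiple of Q for reasons of degree. *)
Lemma irred_coprime Q T : irred Q -> T != 0 ->
  (size T <= size Q)%N -> (sizeY T <= sizeY Q)%N ->
  (forall c, T <> c%:P%:P * Q) ->
  resultant Q T != 0 /\ forall z, fibre z Q = 0 -> fibre z T <> 0.
Proof.
move=> [Q0 irrQ] T0 sT sYT nprop.
(* every common factor of Q and T is a constant *)
have common G Q1 T1 : Q = G * Q1 -> T = G * T1 -> total_degree G = 0%N.
  move=> defQ defT; case: (irrQ _ _ defQ) => // deg0.
  have Q10 : Q1 != 0 by apply: contraNneq Q0 => Q10; rewrite defQ Q10 mulr0.
  have [u u0 defQ1] := total_degree_eq0 Q10 deg0.
  have defG : G = u^-1%:P%:P * Q.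
    by rewrite defQ defQ1 mulrCA -!polyCM mulVf // mulr1.
  pose T2 := u^-1%:P%:P * T1.
  have defT2 : T = T2 * Q by rewrite defT defG mulrAC.
  have T20 : T2 != 0 by apply: contraNneq T0 => T20; rewrite defT2 T20 mul0r.
  have [|c _ defc] := total_degree_eq0 T20; last by case: (nprop c); rewrite -defc.
  have := predn_sizeM T20 Q0; have := predn_sizeYM T20 Q0; rewrite -defT2.
  move: sT sYT; rewrite /total_degree.
  by move: (size T) (size Q) (sizeY T) (sizeY Q) (size T2) (sizeY T2); lia.
split; last first.
  move=> z /fibre_eq0[Q1 defQ] /fibre_eq0[T1 defT].
  by have := common _ _ _ defQ defT; rewrite /total_degree sizeY_polyC size_XsubC addn1.
apply/negP; rewrite resultant_eq0; set G := gcdp Q T => sG.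
have /Pdiv.Idomain.dvdpP[[c H] /= c0] := dvdp_gcdl Q T.
have /Pdiv.Idomain.dvdpP[[c2 H2] /= c20] := dvdp_gcdr Q T.
rewrite -/G -!mul_polyC => eqT eqQ.
have [h [g [H' [G' [_ defG defQ]]]]] := gauss_descent c0 eqQ.
have H'0 : H' != 0 by apply: contraNneq Q0 => H0; rewrite defQ H0 mul0r.
have G'0 : G' != 0 by apply: contraNneq Q0 => H0; rewrite defQ H0 mulr0.
have sG' : (1 < size G')%N.
  apply: leq_trans sG _; rewrite defG mul_polyC; exact: size_scale_leq.
have [u u0 defH'] : exists2 u, u != 0 & H' = u%:P%:P.
  apply: total_degree_eq0 => //; case: (irrQ _ _ defQ) => //.
  by rewrite /total_degree; case: (size G') sG' => [|[]].
have eqT2 : c2%:P * T = (H2 * g%:P * u^-1%:P%:P) * Q.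
  rewrite eqT defG defQ defH' -!mulrA; congr (_ * (_ * _)).
  by rewrite mulrA -!polyCM mulVf // mul1r.
have [h3 [g3 [H3 [Q3 [_ defQ3 defT3]]]]] := gauss_descent c20 eqT2.
have := common Q3 g3%:P H3; rewrite mulrC -defQ3 mulrC -defT3.
move=> /(_ erefl erefl) /eqP.
rewrite addn_eq0 => /andP[s3 _].
have : (1 < size Q)%N.
  rewrite defQ defH' mul_polyC size_scale // polyC_eq0 //.
rewrite defQ3 mul_polyC ltnNge => /negP; apply.
apply: leq_trans (size_scale_leq _ _) _; by case: (size Q3) s3 => [|[]].
Qed.

End Gauss.

(** * Annihilators of least degree *)

Section Annihilators.
Variables (F : closedFieldType) (X : finType) (a b : X -> F).
Implicit Types (P Q T U : {poly {poly F}}) (f : X -> F).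

Definition twist f U x := f x * U.[a x, b x].
Definition nonzero f := exists x, f x != 0.
Definition annihilates f Q := forall x, twist f Q x = 0.
Definition vanishing_moments f L :=
  forall P, bideg L P -> \sum_x f x * P.[a x, b x] = 0.

Lemma twistM f U V : twist (twist f U) V =1 twist f (U * V).
Proof. by move=> x; rewrite /twist !hornerM mulrA. Qed.

Lemma twist1 f : twist f 1 =1 f.
Proof. by move=> x; rewrite /twist !hornerE. Qed.

Lemma eq_nonzero f g : f =1 g -> nonzero f -> nonzero g.
Proof. by move=> fg [x fx]; exists x; rewrite -fg. Qed.

Lemma eq_annihilates f g Q : f =1 g -> annihilates f Q -> annihilates g Q.
Proof. by move=> fg fQ x; rewrite /twist -fg; apply: fQ. Qed.

Lemma twist_annihilates f U Q : annihilates f Q -> annihilates (twist f U) Q.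
Proof. by move=> fQ x; rewrite /twist mulrAC -/(twist f Q x) fQ mul0r. Qed.

Lemma annihilatesP f Q : annihilates f Q \/ nonzero (twist f Q).
Proof.
have [/existsP[x fx]|/existsPn f0] := boolP [exists x, twist f Q x != 0].
  by right; exists x.
by left => x; have := f0 x; rewrite negbK => /eqP.
Qed.

Lemma twist_vanishing_moments f L e U : bideg e U -> vanishing_moments f (e + L) ->
  vanishing_moments (twist f U) L.
Proof.
move=> dU orth P dP; rewrite -[RHS](orth (U * P)); last exact: bidegM.
by apply: eq_bigr => x _; rewrite !hornerM mulrA.
Qed.

Lemma vanishing_momentsW f L L' : (L' <= L)%N ->
  vanishing_moments f L -> vanishing_moments f L'.
Proof. by move=> leL orth P dP; apply: orth; apply: bidegW dP. Qed.

(** If Q = Q1 Q2 is a proper factorization, either f is annihilated by Q2, or f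
    times Q2 is nonzero and annihilated by Q1. The degrees of U and Q together
    never grow. *)
Lemma minimal_annihilator f Q d :
  nonzero f -> Q != 0 -> bideg d Q -> annihilates f Q ->
  exists U Q', [/\ bideg d U, bideg d Q', irred Q', nonzero (twist f U) &
                   annihilates (twist f U) Q'].
Proof.
move=> f0 Q0 dQ fQ.
(* the bound on the sum of the degrees makes the induction carry U along *)
suff: forall U, U != 0 -> nonzero (twist f U) -> annihilates (twist f U) Q ->
    ((size U).-1 + (size Q).-1 <= d)%N -> ((sizeY U).-1 + (sizeY Q).-1 <= d)%N ->
    exists U Q', [/\ bideg d U, bideg d Q', irred Q', nonzero (twist f U) &
                   annihilates (twist f U) Q'].
  move/(_ 1); apply; rewrite ?oner_neq0 //.
  - exact: eq_nonzero (fsym (twist1 f)) f0.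
  - by apply: eq_annihilates fQ => x; rewrite twist1.
  - by rewrite size_poly1; case/andP: dQ; case: (size Q).
  - by rewrite sizeY_polyC size_poly1; case/andP: dQ => _; case: (sizeY Q).
have [n] := ubnP (total_degree Q); elim: n Q Q0 {dQ fQ} => // n IHn Q Q0 degQ.
move=> U U0 fU fUQ dX dY.
have degs (R : nzRingType) (p q : {poly R}) : ((size p).-1 + (size q).-1 <= d)%N ->
    (size p <= d.+1)%N && (size q <= d.+1)%N.
  by move: (size p) (size q) => s t; lia.
have [irrQ|] := EM (irred Q).
  exists U, Q; rewrite /bideg; have /andP[-> ->] := degs _ _ _ dX.
  by rewrite !sizeYE in dY *; have /andP[-> ->] := degs _ _ _ dY.
move=> /not_andP[|/existsNP[Q1 /existsNP[Q2 /not_implyP[defQ /not_orP[/eqP d1 /eqP d2]]]]].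
  by rewrite Q0.
have Q10 : Q1 != 0 by apply: contraNneq Q0 => Q10; rewrite defQ Q10 mul0r.
have Q20 : Q2 != 0 by apply: contraNneq Q0 => Q20; rewrite defQ Q20 mulr0.
move: degQ dX dY; rewrite defQ total_degreeM // predn_sizeM // predn_sizeYM //.
move=> degQ dX dY.
have [fUQ2|fUQ2] := annihilatesP (twist f U) Q2.
  apply: (IHn Q2 Q20 _ U) => //; [by lia | |].
    by move: dX; move: (size U) (size Q1) (size Q2); lia.
  by move: dY; move: (sizeY U) (sizeY Q1) (sizeY Q2); lia.
have [|||||| U' [Q' [? ? ? ? ?]]] := IHn Q1 Q10 _ (U * Q2).
- by lia.
- by rewrite mulf_neq0.
- exact: eq_nonzero (twistM f U Q2) fUQ2.
- apply: eq_annihilates (twistM f U Q2) _ => x.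
  by rewrite twistM mulrC -defQ.
- by rewrite predn_sizeM //; move: dX; move: (size U) (size Q1) (size Q2); lia.
- by rewrite predn_sizeYM //; move: dY; move: (sizeY U) (sizeY Q1) (sizeY Q2); lia.
by exists U', Q'.
Qed.

(** Otherwise f would be annihilated by the coprime polynomials Q and T. *)
Lemma irred_annihilator_unique f Q T d :
  (forall x y, a x = a y -> b x = b y -> x = y) ->
  irred Q -> bideg d Q -> T != 0 ->
  (size T <= size Q)%N -> (sizeY T <= sizeY Q)%N ->
  (forall c, T <> c%:P%:P * Q) ->
  vanishing_moments f (d + d) -> annihilates f Q -> nonzero f -> nonzero (twist f T).
Proof.
move=> inj irrQ dQ T0 sT sYT nprop orth fQ [x0 fx0].
have [fT|//] := annihilatesP f T.
have [res cop] := irred_coprime irrQ T0 sT sYT nprop.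
case/andP: dQ => sQ sYQ.
case/eqP: fx0; apply: (annihilated_by_coprime inj res cop fQ fT sYQ).
  exact: leq_trans sYQ.
move=> P sP sYP; apply: orth; apply/andP; split; last by move: (sizeY P) sYP; lia.
apply: leq_trans sP _; move: (size T) (size Q) sT sQ => s t; lia.
Qed.

End Annihilators.

(** * Subgroups of the plane lattice *)

Section Subgroups.

Lemma int_subgroup_cyclic (H : int -> Prop) : H 0 ->
  (forall x y, H x -> H y -> H (x - y)) ->
  exists2 g, H g & forall x, H x -> (g %| x)%Z.
Proof.
move=> H0 HB.
have HN x : H x -> H (- x) by move=> Hx; rewrite -sub0r; apply: HB.
have HD x y : H x -> H y -> H (x + y).
  by move=> Hx Hy; rewrite -[y]opprK; apply: HB => //; apply: HN.
have HMn x n : H x -> H (x *+ n).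
  by move=> Hx; elim: n => [|n IHn]; rewrite ?mulr0n // mulrS; apply: HD.
have HM x c : H x -> H (c * x).
  move=> Hx; case: c => n; first by rewrite -[Posz n]natz mulr_natl; apply: HMn.
  by rewrite NegzE mulNr -[Posz _]natz mulr_natl; apply/HN/HMn.
have [[n Hn n_gt0]|noH] := EM (exists2 n : nat, H n%:Z & (0 < n)%N); last first.
  exists 0 => // x Hx; rewrite dvd0z -absz_eq0 -leqn0 leqNgt; apply/negP => x_gt0.
  apply: noH; exists `|x|%N => //; rewrite abszE.
  have [x_ge0|x_lt0] := lerP 0 x; first by rewrite ger0_norm.
  by rewrite ltr0_norm //; apply: HN.
have exH : exists n : nat, `[< H n%:Z >] && (0 < n)%N.
  by exists n; rewrite n_gt0 andbT; apply/asboolP.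
case: (ex_minnP exH) => g /andP[/asboolP Hg g_gt0] ming.
exists g%:Z => // x Hx; apply/dvdz_mod0P; have [//|xg] := eqVneq (x %% g)%Z 0.
have g_neq0 : g%:Z != 0 by rewrite eqz_nat -lt0n.
have := ming `|(x %% g)%Z|%N; rewrite absz_gt0 xg andbT.
have -> : `|(x %% g)%Z|%N%:Z = (x %% g)%Z by apply: gez0_abs; apply: modz_ge0.
have Hm : H (x %% g)%Z by rewrite /modz; apply: HB => //; apply: HM.
move=> /(_ (asboolT Hm)); have := ltz_pmod x (_ : 0 < g%:Z).
have := modz_ge0 x g_neq0; lia.
Qed.

(** One generator projects onto the generator of the first projection of H, the
    other generates the elements of H with first coordinate 0. *)
Lemma int2_subgroup_two_generated (H : int * int -> Prop) : H 0 ->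
  (forall r s, H r -> H s -> H (r - s)) ->
  exists r1 r2, [/\ H r1, H r2 &
    forall r, H r -> exists s t, r = (s * r1.1 + t * r2.1, s * r1.2 + t * r2.2)].
Proof.
move=> H0 HB.
have HN x : H x -> H (- x) by move=> Hx; rewrite -sub0r; apply: HB.
have HD x y : H x -> H y -> H (x + y).
  by move=> Hx Hy; rewrite -[y]opprK; apply: HB => //; apply: HN.
have HMn x (n : nat) : H x -> H (n%:Z * x.1, n%:Z * x.2).
  move=> Hx; elim: n => [|n IHn]; first by rewrite !mul0r.
  suff -> : (n.+1%:Z * x.1, n.+1%:Z * x.2) = x + (n%:Z * x.1, n%:Z * x.2) by apply: HD.
  by apply: injective_projections => /=; rewrite intS mulrDl mul1r.
have HM x c : H x -> H (c * x.1, c * x.2).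
  move=> Hx; case: c => n; first exact: HMn.
  suff -> : (Negz n * x.1, Negz n * x.2) = - (n.+1%:Z * x.1, n.+1%:Z * x.2).
    exact/HN/HMn.
  by apply: injective_projections => /=; rewrite NegzE mulNr.
have [||a [b Hab] genA] := @int_subgroup_cyclic (fun a => exists b, H (a, b)).
- by exists 0.
- by move=> x y [bx Hx] [by_ Hy]; exists (bx - by_); apply: HB Hx Hy.
have [||c Hc genC] := @int_subgroup_cyclic (fun c => H (0, c)).
- exact: H0.
- by move=> x y Hx Hy; apply: (HB (0, x) (0, y)).
exists (a, b), (0, c); split=> // -[p q] Hpq.
have /dvdzP[s defp] : (a %| p)%Z by apply: genA; exists q.
have /dvdzP[t deft] : (c %| q - s * b)%Z.
  apply: genC; have := HB _ _ Hpq (HM _ s Hab).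
  suff -> : (p, q) - (s * a, s * b) = (0, q - s * b) by [].
  by rewrite defp; apply: injective_projections => //=; rewrite subrr.
by exists s, t; rewrite /= mulr0 addr0 -defp -deft; congr pair; ring.
Qed.

End Subgroups.

(** * Galois conjugates of an annihilator *)

Section Conjugate.
Variables (F : closedFieldType) (sigma : {rmorphism F -> F}).
Implicit Types (P Q T U : {poly {poly F}}).

Lemma horner2_coef Q x y :
  Q.[x, y] = \sum_(i < size Q) \sum_(j < size Q`_i) Q`_i`_j * x ^+ i * y ^+ j.
Proof.
rewrite [Q.[_]]horner_coef horner_sum; apply: eq_bigr => i _.
rewrite hornerM -polyC_exp hornerC horner_coef mulr_suml.
by apply: eq_bigr => j _; rewrite mulrAC.
Qed.

(** sigma is applied to the coefficients, and the variables are scaled by r and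
    s: if sigma multiplies the coordinates x and y by r and s, then the zero
    (x, y) of Q is again a zero of the result ([conjugate_root]). *)
Definition conjugate (r s : F) Q : {poly {poly F}} :=
  \poly_(i < size Q) \poly_(j < size Q`_i) (sigma Q`_i`_j * r ^+ i * s ^+ j).

Lemma coef_conjugate r s Q i j :
  (conjugate r s Q)`_i`_j = sigma Q`_i`_j * r ^+ i * s ^+ j.
Proof.
rewrite coef_poly; case: ltnP => [_|le_i]; last first.
  by rewrite (nth_default 0 le_i) !coef0 rmorph0 !mul0r.
by rewrite coef_poly; case: ltnP => // le_j; rewrite (nth_default 0 le_j) rmorph0 !mul0r.
Qed.

Lemma size_conjugate r s Q : (size (conjugate r s Q) <= size Q)%N.
Proof. exact: size_poly. Qed.

Lemma sizeY_conjugate r s Q : (sizeY (conjugate r s Q) <= sizeY Q)%N.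
Proof.
apply/bigmax_leqP => i _; apply: leq_trans (max_size_coefXY Q i).
rewrite coef_poly; case: ifP => _; last by rewrite size_poly0.
exact: size_poly.
Qed.

Lemma horner2_conjugate r s Q x y :
  (conjugate r s Q).[x, y] =
    \sum_(i < size Q) \sum_(j < size Q`_i)
      sigma Q`_i`_j * (r * x) ^+ i * (s * y) ^+ j.
Proof.
rewrite [(conjugate _ _ _).[_]]horner_poly horner_sum; apply: eq_bigr => i _.
rewrite hornerM -polyC_exp hornerC horner_poly mulr_suml.
by apply: eq_bigr => j _; rewrite !exprMn; ring.
Qed.

Lemma conjugate_root r s Q x y : sigma x = r * x -> sigma y = s * y ->
  (conjugate r s Q).[x, y] = sigma Q.[x, y].
Proof.
move=> sx sy; rewrite horner2_conjugate horner2_coef rmorph_sum.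
apply: eq_bigr => i _; rewrite rmorph_sum; apply: eq_bigr => j _.
by rewrite !rmorphM !rmorphXn /= sx sy.
Qed.

End Conjugate.

Section KillClasses.
Variables (F : closedFieldType) (X I : finType) (a b : X -> F).
Notation twist := (twist a b).

(** The classes are treated one by one. If some surviving point x of a class is
    not good, multiplication by T x kills the whole class but not the function;
    if there is none, nothing has to be done. *)
Lemma kill_classes (f : X -> F) (cl : X -> I) (T : X -> {poly {poly F}})
    (good : X -> Prop) d :
  nonzero f ->
  (forall x, f x != 0 -> bideg d (T x)) ->
  (forall x y, f x != 0 -> f y != 0 -> cl x = cl y -> twist f (T x) y = 0) ->
  (forall U x, bideg (#|I| * d) U -> nonzero (twist f U) -> f x != 0 -> ~ good x ->
     nonzero (twist (twist f U) (T x))) ->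
  exists U, [/\ bideg (#|I| * d) U, nonzero (twist f U) &
    forall x, twist f U x != 0 -> good x].
Proof.
move=> f0 dT killT stepT.
have tw0 g V x : twist g V x != 0 -> g x != 0.
  by apply: contraNneq => g0; rewrite /twist g0 mul0r.
suff: forall s : seq I, (size s <= #|I|)%N ->
    exists U, [/\ bideg (size s * d) U, nonzero (twist f U) &
      forall x, twist f U x != 0 -> cl x \in s -> good x].
  move=> /(_ (enum I)); rewrite -cardE => /(_ (leqnn _))[U [dU fU gU]].
  by exists U; split=> // x fx; apply: gU fx _; rewrite mem_enum.
elim=> [_|i s IHs s_lt].
  exists 1; split=> //; first by rewrite /bideg sizeY_polyC !size_poly1.
  exact: eq_nonzero (fsym (twist1 _ _ f)) f0.
have [U [dU fU gU]] := IHs (ltnW s_lt).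
have [[x [fx clx nx]]|all_good] :=
    EM (exists x, [/\ twist f U x != 0, cl x = i & ~ good x]); last first.
  exists U; split=> //; first by apply: bidegW dU; rewrite leq_mul2r leqnSn orbT.
  move=> x fx; rewrite inE => /orP[/eqP clx|]; last exact: gU.
  by apply: contrapT => nx; apply: all_good; exists x.
have dT' := dT x (tw0 _ _ _ fx).
exists (T x * U); split.
- by rewrite mulSn; apply: bidegM.
- have dU' : bideg (#|I| * d) U by apply: bidegW dU; rewrite leq_mul2r ltnW ?orbT.
  apply: eq_nonzero (stepT U x dU' fU (tw0 _ _ _ fx) nx) => y.
  by rewrite twistM mulrC.
move=> y fy; rewrite inE => /orP[/eqP cly|].
  case/eqP: (fy); rewrite -twistM {1}/twist killT ?mul0r //; last by rewrite clx.
    exact: tw0 fx.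
  by apply: tw0 (T x * U) _ fy.
apply: gU; apply: contraNneq fy => fy.
by rewrite mulrC -twistM {1}/twist fy mul0r.
Qed.

End KillClasses.

Definition dot N (x : grid N) (r : int * int) : int :=
  (x.1 : nat)%:Z * r.1 + (x.2 : nat)%:Z * r.2.

Lemma dotB N (x : grid N) r s : dot x (r - s) = dot x r - dot x s.
Proof. by rewrite /dot /=; ring. Qed.

Definition on_line N (e : int * int) (c : int) (x : grid N) := (N%:Z %| dot x e - c)%Z.

Section Level.
Variables (N : nat) (z : algC).
Hypothesis z_prim : N.-primitive_root z.
Notation pt1 := (fun x : grid N => z ^+ x.1).
Notation pt2 := (fun x : grid N => z ^+ x.2).
Notation twist := (twist pt1 pt2).
Notation annihilates := (annihilates pt1 pt2).
Notation vanishing_moments := (vanishing_moments pt1 pt2).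
Implicit Types (f : grid N -> algC) (P Q T U : {poly {poly algC}}).

Lemma points_inj (x y : grid N) : z ^+ x.1 = z ^+ y.1 -> z ^+ x.2 = z ^+ y.2 -> x = y.
Proof.
move=> /eqP; rewrite (eq_prim_root_expr z_prim) !modn_small // => /eqP xy1.
move=> /eqP; rewrite (eq_prim_root_expr z_prim) !modn_small // => /eqP xy2.
by apply: injective_projections; apply: val_inj.
Qed.

Definition exponent Q (u : nat * nat) := Q`_u.1`_u.2 != 0.

Lemma exponent_exists Q : Q != 0 -> exists u, exponent Q u.
Proof.
move=> Q0; exists ((size Q).-1, (size (lead_coef Q)).-1); rewrite /exponent /=.
by rewrite -[Q`_ _]/(lead_coef Q) -[_`_ _]/(lead_coef (lead_coef Q)) !lead_coef_eq0.
Qed.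

Definition diff (u v : nat * nat) : int * int :=
  (u.1%:Z - v.1%:Z, u.2%:Z - v.2%:Z).

(** This is what the successive multiplications improve, from m = 1 to
    m = M^(k-1): the support of f is contained in a single class modulo m of
    each linear form given by a difference of exponents of Q. *)
Definition level (m : nat) f Q := forall x y u v, f x != 0 -> f y != 0 ->
  exponent Q u -> exponent Q v -> (m%:Z %| dot x (diff u v) - dot y (diff u v))%Z.

(** The automorphism sigma : z -> z^(1+n) sends Q to polynomials T x that vanish
    at x when Q does. The coefficients of T x are those of the polynomial sigma Q
    multiplied by z^(n x.u), so that T x and T y are proportional when x.(u - v)
    and y.(u - v) agree modulo m M = N / n for all exponents u, v of Q. They
    agree modulo m by hypothesis, and the differences u - v lie in a group
    with two generators; this leaves at most M choices for each generator. After
    the non-proportional classes are killed, all T x are multiples of Q, hence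
    proportional to each other, which is the congruence modulo m M. *)
Lemma level_step M m n f Q d : N = (n * (m * M))%N -> (0 < M)%N ->
  coprime n.+1 N -> level m f Q -> irred Q -> bideg d Q -> annihilates f Q ->
  nonzero f -> vanishing_moments f (M * M * d + (d + d)) ->
  exists U, [/\ bideg (M * M * d) U, nonzero (twist f U) &
                level (m * M) (twist f U) Q].
Proof.
move=> defN M_gt0 co_n lev irrQ dQ fQ f0 orth.
have N_gt0 : (0 < N)%N := prim_order_gt0 z_prim.
have n_gt0 : (0 < n)%N by move: N_gt0; rewrite defN muln_gt0 => /andP[].
have m_gt0 : (0 < m)%N by move: N_gt0; rewrite defN !muln_gt0 => /and3P[].
have [sigma sigmaE] := Qn_aut_exists co_n.
have sigma_z e : sigma (z ^+ e) = z ^+ (n * e) * z ^+ e.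
  rewrite sigmaE; first by rewrite -exprM -exprD mulnC mulSn addnC.
  by rewrite exprAC (prim_expr_order z_prim) expr1n.
have z_eq A B : (z ^+ (n * A) == z ^+ (n * B)) = ((m * M)%:Z %| A%:Z - B%:Z)%Z.
  rewrite (eq_prim_root_expr z_prim) defN -!muln_modr eqn_pmul2l //.
  by rewrite -eqz_mod_dvd !modz_nat.
pose T (x : grid N) := conjugate sigma (z ^+ (n * x.1)) (z ^+ (n * x.2)) Q.
have [Q0 _] := irrQ.
have [u0 Qu0] := exponent_exists Q0.
have TE x u : (T x)`_u.1`_u.2 = sigma Q`_u.1`_u.2 * z ^+ (n * (x.1 * u.1 + x.2 * u.2)).
  by rewrite coef_conjugate -mulrA -!exprM -exprD mulnDr !mulnA.
have z0 e : z ^+ e != 0 by rewrite expf_neq0 // (prim_root_eq0 z_prim) -lt0n.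
have Tx0 x : T x != 0.
  apply: contraNneq Qu0 => Tx; have /eqP := TE x u0; rewrite Tx !coef0 eq_sym.
  by rewrite mulf_eq0 (negPf (z0 _)) orbF fmorph_eq0.
have T_root x : (T x).[z ^+ x.1, z ^+ x.2] = sigma Q.[z ^+ x.1, z ^+ x.2].
  by rewrite conjugate_root // sigma_z.
have Q_root x : f x != 0 -> Q.[z ^+ x.1, z ^+ x.2] = 0.
  by move=> fx; have /eqP := fQ x; rewrite mulf_eq0 (negPf fx) => /eqP.
have same (x y : grid N) u v :
    (z ^+ (n * (x.1 * u.1 + x.2 * u.2)) * z ^+ (n * (y.1 * v.1 + y.2 * v.2)) ==
      z ^+ (n * (x.1 * v.1 + x.2 * v.2)) * z ^+ (n * (y.1 * u.1 + y.2 * u.2))) =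
    ((m * M)%:Z %| dot x (diff u v) - dot y (diff u v))%Z.
  rewrite -!exprD -!mulnDr z_eq; congr (_ %| _)%Z.
  by rewrite /dot /diff /= !PoszD !PoszM; ring.
(* the group of linear forms that are constant modulo m on the support of f *)
pose H r := forall x y, f x != 0 -> f y != 0 -> (m%:Z %| dot x r - dot y r)%Z.
have [||r1 [r2 [Hr1 Hr2 genH]]] := @int2_subgroup_two_generated H.
- by move=> x y _ _; rewrite /dot /= !mulr0 subrr dvdz0.
- move=> r s Hr Hs x y fx fy; rewrite !dotB.
  have -> : dot x r - dot x s - (dot y r - dot y s) =
    (dot x r - dot y r) - (dot x s - dot y s) by ring.
  by rewrite rpredB //; [apply: Hr | apply: Hs].
have [x0 fx0] := f0.
(* c r x is the residue modulo M of (x - x0).r / m *)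
pose c r (x : grid N) : 'I_M :=
  Ordinal (ltn_pmod (absz (((dot x r - dot x0 r)%R %/ m)%Z %% M)%Z) M_gt0).
have cP r x y : H r -> f x != 0 -> f y != 0 -> c r x = c r y ->
    ((m * M)%:Z %| dot x r - dot y r)%Z.
  move=> Hr fx fy /(congr1 val) /=.
  have M0 : M%:Z != 0 by rewrite eqz_nat -lt0n.
  have absM e : (absz (e %% M)%Z %% M)%N = absz (e %% M)%Z.
    rewrite modn_small // -ltz_nat gez0_abs ?modz_ge0 //.
    by apply: ltz_pmod; rewrite ltz_nat.
  rewrite !absM => /(congr1 Posz); rewrite !gez0_abs ?modz_ge0 //.
  have /dvdzP[e eqx] := Hr _ _ fx fx0; have /dvdzP[e' eqy] := Hr _ _ fy fx0.
  have m0 : m%:Z != 0 by rewrite eqz_nat -lt0n.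
  rewrite eqx eqy !mulzK // => /eqP; rewrite eqz_mod_dvd => /dvdzP[g eqg].
  apply/dvdzP; exists g; rewrite PoszM.
  have -> : dot x r - dot y r = (dot x r - dot x0 r) - (dot y r - dot x0 r) by ring.
  by rewrite eqx eqy -mulrBl eqg; ring.
pose cl x := (c r1 x, c r2 x).
have clP x y u v : exponent Q u -> exponent Q v -> f x != 0 -> f y != 0 ->
    cl x = cl y -> ((m * M)%:Z %| dot x (diff u v) - dot y (diff u v))%Z.
  move=> Qu Qv fx fy clxy.
  have /dvdzP[e1 eq1] := cP _ _ _ Hr1 fx fy (congr1 fst clxy).
  have /dvdzP[e2 eq2] := cP _ _ _ Hr2 fx fy (congr1 snd clxy).
  have [|s [t ->]] := genH (diff u v); first by move=> x' y' fx' fy'; apply: lev.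
  apply/dvdzP; exists (s * e1 + t * e2).
  rewrite mulrDl -!mulrA -eq1 -eq2 /dot /=; ring.
(* points of the same class have proportional conjugates *)
have killT x y : f x != 0 -> f y != 0 -> cl x = cl y -> twist f (T x) y = 0.
  move=> fx fy clxy; rewrite /twist.
  pose k (x : grid N) := z ^+ (n * (x.1 * u0.1 + x.2 * u0.2)) : algC.
  suff -> : T x = (k x / k y)%:P%:P * T y.
    by rewrite !hornerM T_root Q_root // rmorph0 !mulr0.
  apply/polyP => i; apply/polyP => j; rewrite !coefCM.
  have := TE x (i, j); have := TE y (i, j) => /= -> ->.
  have [->|Qij] := eqVneq Q`_i`_j 0; first by rewrite rmorph0 !mul0r mulr0.
  rewrite mulrCA mulrAC; congr (_ * _); apply: (canRL (mulfK (z0 _))).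
  have := clP _ _ (i, j) u0 Qij Qu0 fx fy clxy; rewrite -same => /eqP /= ->.
  by [].
pose good x := exists c, T x = c%:P%:P * Q.
have dT x : bideg d (T x).
  case/andP: dQ => sQ sYQ; apply/andP; split.
    exact: leq_trans (size_conjugate _ _ _ _) sQ.
  exact: leq_trans (sizeY_conjugate _ _ _ _) sYQ.
have [|U x dU fU fx nx|U [dU fU gU]] := kill_classes (good := good) (d := d) f0 _ killT.
- by move=> x _; apply: dT.
- have inj x' y' := @points_inj x' y'.
  apply: (irred_annihilator_unique inj irrQ dQ (Tx0 x)) => //.
  + exact: size_conjugate.
  + exact: sizeY_conjugate.
  + by move=> e defT; apply: nx; exists e.
  + apply: twist_vanishing_moments dU _; rewrite card_prod card_ord.
    exact: orth.
  + exact: twist_annihilates.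
exists U; rewrite card_prod card_ord in dU; split=> // x y u v fx fy Qu Qv.
have fx' : f x != 0 by apply: contraNneq fx => fx; rewrite /twist fx mul0r.
have [e1 def1] := gU x fx; have [e2 def2] := gU y fy.
(* the coefficients of T x = e1 Q and T y = e2 Q at two exponents u, v determine
   z^(n x.(u - v)) and z^(n y.(u - v)), and the scalars e1, e2 drop out *)
have E1 w : sigma Q`_w.1`_w.2 * z ^+ (n * (x.1 * w.1 + x.2 * w.2)) = e1 * Q`_w.1`_w.2.
  by rewrite -TE def1 !coefCM.
have E2 w : sigma Q`_w.1`_w.2 * z ^+ (n * (y.1 * w.1 + y.2 * w.2)) = e2 * Q`_w.1`_w.2.
  by rewrite -TE def2 !coefCM.
rewrite -same; apply/eqP.
have suv : sigma Q`_u.1`_u.2 * sigma Q`_v.1`_v.2 != 0 by rewrite mulf_neq0 ?fmorph_eq0.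
apply: (mulfI suv); rewrite mulrACA E1 E2 [RHS]mulrACA.
transitivity ((sigma Q`_v.1`_v.2 * z ^+ (n * (x.1 * v.1 + x.2 * v.2))) *
              (sigma Q`_u.1`_u.2 * z ^+ (n * (y.1 * u.1 + y.2 * u.2)))); last by ring.
by rewrite E1 E2; ring.
Qed.

End Level.

(** * Concentration on one line *)

Lemma prim_exprz_eq1 (F : fieldType) N (z : F) (e : int) :
  N.-primitive_root z -> (z ^ e == 1) = (N%:Z %| e)%Z.
Proof.
move=> z_prim; rewrite dvdzE absz_nat (prim_order_dvd z_prim).
case: e => n; first by rewrite -exprnP absz_nat.
by rewrite NegzE -exprnN abszN absz_nat invr_eq1.
Qed.

Lemma eq_prim_root_exprz (F : fieldType) N (z : F) (m n : int) :
  N.-primitive_root z -> (z ^ m == z ^ n) = (N%:Z %| m - n)%Z.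
Proof.
move=> z_prim; have z0 : z != 0.
  by rewrite (prim_root_eq0 z_prim) -lt0n (prim_order_gt0 z_prim).
rewrite -[m in LHS](subrK n) expfzDr // -[X in _ == X]mul1r.
by rewrite (inj_eq (mulIf (expfz_neq0 n z0))) (prim_exprz_eq1 _ z_prim).
Qed.

Section BidegProd.
Variable F : idomainType.

Lemma bideg_prod (I : Type) (s : seq I) (G : I -> {poly {poly F}}) h :
  (forall i, bideg h (G i)) -> bideg (size s * h) (\prod_(i <- s) G i).
Proof.
move=> dG; elim: s => [|i s IHs].
  by rewrite big_nil /bideg sizeY_polyC !size_poly1.
by rewrite big_cons mulSn; apply: bidegM.
Qed.

Lemma bideg_monomial (c : F) i j d : (i <= d)%N -> (j <= d)%N ->
  bideg d ((c%:P * 'X^j)%:P * 'X^i).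
Proof.
move=> le_i le_j; apply/andP; split.
  rewrite mul_polyC; apply: leq_trans (size_scale_leq _ _) _.
  by rewrite size_polyXn.
apply/bigmax_leqP => k _; rewrite coefCM coefXn.
case: (_ == _); last by rewrite mulr0 size_poly0.
by rewrite mulr1 mul_polyC; apply: leq_trans (size_scale_leq _ _) _; rewrite size_polyXn.
Qed.

Lemma bidegD d (P Q : {poly {poly F}}) : bideg d P -> bideg d Q -> bideg d (P + Q).
Proof.
rewrite /bideg !sizeYE rmorphD => /andP[sP sP'] /andP[sQ sQ'].
by rewrite !(leq_trans (size_polyD _ _)) // geq_max ?sP ?sP'.
Qed.

Lemma horner2_monomial (c : F) i j x y :
  ((c%:P * 'X^j)%:P * 'X^i).[x, y] = c * x ^+ i * y ^+ j.
Proof. by rewrite !hornerE /= mulrAC. Qed.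

End BidegProd.

Section Levels.
Variables (M k : nat) (z : algC).
Hypothesis (M_gt0 : (0 < M)%N) (z_prim : (M ^ k).-primitive_root z).
Notation N := (M ^ k)%N.
Notation pt1 := (fun x : grid N => z ^+ x.1).
Notation pt2 := (fun x : grid N => z ^+ x.2).
Notation twist := (twist pt1 pt2).
Notation annihilates := (annihilates pt1 pt2).
Notation vanishing_moments := (vanishing_moments pt1 pt2).
Implicit Types (f : grid N -> algC) (P Q T U : {poly {poly algC}}).

(** The automorphism used at level M^j multiplies exponents by 1 + M^(k-j-1),
    which is prime to M as long as j < k-1; so the process stops at M^(k-1). *)
Lemma all_levels f Q d L : irred Q -> bideg d Q -> annihilates f Q ->
  nonzero f -> vanishing_moments f (k * (M * M * d) + (d + d) + L) ->
  exists U, [/\ bideg (k.-1 * (M * M * d)) U, nonzero (twist f U) &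
                level (M ^ k.-1) (twist f U) Q].
Proof.
move=> irrQ dQ fQ f0 mom; elim: {-2}k.-1 (leqnn k.-1) => [_|j IHj lt_j].
  exists 1; split.
  - by rewrite mul0n /bideg sizeY_polyC !size_poly1.
  - exact: eq_nonzero (fsym (twist1 _ _ f)) f0.
  - by move=> x y u v *; rewrite expn0 dvd1z.
have [U [dU fU lev]] := IHj (ltnW lt_j).
have [n n_def] : exists n, n = (M ^ (k - j.+1))%N by exists (M ^ (k - j.+1))%N.
have defN : (N = n * (M ^ j * M))%N by rewrite n_def -expnSr -expnD subnK //; lia.
have co_n : coprime n.+1 N.
  apply: coprimeXr; apply: coprime_dvdr (coprimeSn n).
  by rewrite n_def -[X in (X %| _)%N]expn1; apply: dvdn_exp2l; lia.
have [||V [dV fV levV]] := level_step z_prim defN M_gt0 co_n lev irrQ dQ _ fU.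
- exact: twist_annihilates.
- apply: twist_vanishing_moments dU _; apply: vanishing_momentsW mom.
  have : (j.+1 * (M * M * d) <= k * (M * M * d))%N by rewrite leq_mul2r; lia.
  by move: (M * M * d)%N => e; rewrite mulSn; lia.
exists (U * V); split.
- by rewrite mulSn addnC; apply: bidegM.
- exact: eq_nonzero (twistM _ _ _ _ _) fV.
- by move=> x y u v; rewrite -!twistM expnSr; apply: levV.
Qed.

(** Q has two exponents u, v, since a monomial does not vanish at a point with
    nonzero coordinates. Write u - v = t (a, b) with a, b coprime. The level says
    that w x = z^(x.(a,b)) takes at most M |t| values on the support of f, as the
    M |t|-th powers of these values agree. The product of the binomials w - y over
    all values y but one keeps f on one line, and each of them has bidegree
    max(|a|, |b|), which is at most d / |t|. *)
Lemma separate_lines f Q d : irred Q -> bideg d Q -> annihilates f Q ->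
  nonzero f -> (0 < k)%N -> level (M ^ k.-1) f Q ->
  exists a b c : int, exists U, [/\ coprimez a b, (`|a| <= d)%N && (`|b| <= d)%N,
    bideg (M * d) U, nonzero (twist f U) &
    forall x, twist f U x != 0 -> on_line (a, b) c x].
Proof.
move=> [Q0 _] dQ fQ [x0 fx0] k_gt0 lev.
have [u [v [Qu Qv uv]]] : exists u v, [/\ exponent Q u, exponent Q v & u != v].
  have [u Qu] := exponent_exists Q0.
  exists u; apply: contrapT => /forallNP noexp.
  have mono w : w != u -> Q`_w.1`_w.2 = 0.
    move=> wu; apply/eqP/negPn/negP => Qw; apply: (noexp w); split=> //.
    by rewrite eq_sym.
  have defQ : Q = ((Q`_u.1`_u.2)%:P * 'X^(u.2))%:P * 'X^(u.1).
    apply/polyP => i; apply/polyP => j; rewrite coefCM coefXn mulr_natr coefMn coefCM coefXn.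
    have [eq_ij|ij] := eqVneq (i, j) u.
      by rewrite -eq_ij /= !eqxx mulr1.
    rewrite (mono _ ij) /= -[_ *+ (i == _)]mulr_natr -mulrA -natrM mulnb.
    rewrite (_ : _ && _ = false) ?mulr0 //; apply/negP => /andP[/eqP ej /eqP ei].
    by case/eqP: ij; rewrite [RHS]surjective_pairing ei ej.
  have := fQ x0; rewrite /twist {1}defQ horner2_monomial => /eqP.
  rewrite !mulf_eq0 (negPf fx0) (negPf Qu) !expf_eq0.
  by rewrite (prim_root_eq0 z_prim) eqn0Ngt (prim_order_gt0 z_prim) !andbF.
pose t := gcdz (diff u v).1 (diff u v).2.
have diff0 : ((diff u v).1 != 0) || ((diff u v).2 != 0).
  apply: contraNT uv; rewrite negb_or !negbK !subr_eq0 !eqz_nat => /andP[/eqP e1 /eqP e2].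
  by rewrite [u]surjective_pairing [v]surjective_pairing e1 e2.
have t_gt0 : (0 < `|t|)%N by rewrite absz_gt0 gcdz_eq0 negb_and.
have [a [b [co_ab def1 def2]]] : exists a b, [/\ coprimez a b,
    (diff u v).1 = a * t & (diff u v).2 = b * t].
  have /dvdzP[a def1] : (t %| (diff u v).1)%Z by apply: dvdz_gcdl.
  have /dvdzP[b def2] : (t %| (diff u v).2)%Z by apply: dvdz_gcdr.
  exists a, b; split=> //; rewrite /coprimez.
  have t0 : t != 0 by rewrite -absz_gt0.
  have : gcdz (a * t) (b * t) = t by rewrite -def1 -def2.
  rewrite -mulz_gcdl [X in _ * X = _](_ : _ = t); last by rewrite /t /gcdz absz_nat.
  by rewrite -[RHS]mul1r => /(mulIf t0) ->.
have bound w : exponent Q w -> (w.1 <= d)%N && (w.2 <= d)%N.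
  move=> Qw; case/andP: dQ => sQ sYQ; apply/andP; split; rewrite -ltnS.
    apply: leq_trans sQ; rewrite ltnNge; apply: contra Qw => le_w.
    by rewrite (nth_default 0 le_w) coef0.
  apply: leq_trans (leq_trans (max_size_coefXY Q w.1) sYQ).
  by rewrite ltnNge; apply: contra Qw => le_w; rewrite (nth_default 0 le_w).
have /andP[u1 u2] := bound u Qu; have /andP[v1 v2] := bound v Qv.
have le_a : (`|a| * `|t| <= d)%N by rewrite -abszM -def1 /diff /=; lia.
have le_b : (`|b| * `|t| <= d)%N by rewrite -abszM -def2 /diff /=; lia.
have le_h e : (`|e| * `|t| <= d)%N -> (`|e| <= d)%N.
  by apply: leq_trans; rewrite leq_pmulr.
pose e := (a, b).
have z0 : z != 0 by rewrite (prim_root_eq0 z_prim) -lt0n (prim_order_gt0 z_prim).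
pose w (x : grid N) := z ^ (dot x e).
have w0 x : w x != 0 by apply: expfz_neq0.
have wdiv x y : w x / w y = z ^ (dot x e - dot y e).
  by rewrite [RHS]expfzDr // -invr_expz.
pose h := maxn `|a|%N `|b|%N.
(* ps is the positive part; G y is w - y with its negative powers cleared *)
pose ps (c : int) := if 0 <= c then `|c|%N else 0%N.
pose G (y : algC) : {poly {poly algC}} :=
  (1%:P * 'X^(ps b))%:P * 'X^(ps a) + ((- y)%:P * 'X^(ps (- b)))%:P * 'X^(ps (- a)).
have psh c : (`|c| <= h)%N -> (ps c <= h)%N by rewrite /ps; case: ifP.
have [ah bh] : (`|a| <= h)%N /\ (`|b| <= h)%N by rewrite leq_maxl leq_maxr.
have dG y : bideg h (G y).
  by apply: bidegD; apply: bideg_monomial; apply: psh; rewrite ?abszN.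
have psE c : c = (ps c)%:Z - (ps (- c))%:Z.
  rewrite /ps oppr_ge0; case: (ltgtP 0 c) => c0; rewrite ?abszN; lia.
have evG y (x : grid N) : (G y).[z ^+ x.1, z ^+ x.2] =
    z ^+ (x.1 * ps (- a) + x.2 * ps (- b)) * (w x - y).
  rewrite /G !hornerD !horner2_monomial -!exprM mul1r -!exprD -mulrA -exprD.
  rewrite mulrBr mulNr [y * _]mulrC; congr (_ - _).
  rewrite !exprnP /w -expfzDr //; congr (z ^ _).
  move: (psE a) (psE b); rewrite /dot /e /=.
  move: (ps a) (ps (- a)) (ps b) (ps (- b)) => p p' q q' ea eb.
  by rewrite ea eb !PoszD !PoszM; ring.
(* normalized at x0, the values are roots of unity and that of x0 is 1 *)
pose W := undup [seq w x / w x0 | x <- enum {: grid N} & f x != 0].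
have unityW : all (M * `|t|).-unity_root W.
  apply/allP => y; rewrite mem_undup => /mapP[x]; rewrite mem_filter => /andP[fx _] ->.
  apply/unity_rootP; rewrite wdiv exprnP exprz_exp; apply/eqP.
  rewrite (prim_exprz_eq1 _ z_prim).
  have := lev x x0 u v fx fx0 Qu Qv => /dvdzP[q defq]; apply/dvdzP; exists q.
  have defN : N%:Z = (M ^ k.-1)%:Z * M%:Z by rewrite -PoszM -expnSr prednK.
  rewrite defN mulrA -defq PoszM -/t gez0_abs // /dot def1 def2 /e /=; ring.
have sW : (size W <= M * `|t|)%N.
  by apply: max_unity_roots unityW (undup_uniq _); rewrite muln_gt0 M_gt0.
pose U := \prod_(y <- [seq y <- W | y != 1]) G (y * w x0).
have evU (x : grid N) : U.[z ^+ x.1, z ^+ x.2] =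
    \prod_(y <- [seq y <- W | y != 1]) (G (y * w x0)).[z ^+ x.1, z ^+ x.2].
  by rewrite /U !horner_prod.
exists a, b, (dot x0 e), U; split=> //.
- by rewrite !le_h.
- apply: bidegW (bideg_prod _ (fun y => dG (y * w x0))).
  rewrite size_filter; apply: leq_trans (leq_mul (count_size _ _) (leqnn h)) _.
  apply: leq_trans (leq_mul sW (leqnn h)) _.
  by rewrite -mulnA leq_mul2l mulnC /h maxnMl geq_max le_a le_b orbT.
- exists x0; rewrite /twist /= evU mulf_neq0 // prodf_seq_neq0; apply/allP => y.
  rewrite mem_filter => /andP[y1 _]; rewrite /= evG -[w x0 in X in X - _]mul1r -mulrBl.
  by rewrite !mulf_neq0 ?expf_neq0 // subr_eq0 eq_sym.
move=> x fUx; have fx : f x != 0.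
  by apply: contraNneq fUx => fx; rewrite /twist fx mul0r.
rewrite /on_line -(prim_exprz_eq1 _ z_prim) -wdiv; apply: contraNT fUx => wx.
rewrite /twist /= evU (big_rem (w x / w x0)) /=.
  by rewrite evG divfK // subrr mulr0 mul0r mulr0.
rewrite mem_filter wx mem_undup /=; apply/mapP; exists x => //.
by rewrite mem_filter fx mem_enum.
Qed.

End Levels.

(** * Values of a primitive linear form on a square *)

Section Interpolation.
Variables (F : fieldType) (X : finType).

(** Otherwise a polynomial of degree less than n separates one point of the
    support of g from the others. *)
Lemma support_gt_vanishing_powers (g y : X -> F) (n0 : int) (n : nat) :
  (forall x, y x != 0) ->
  (forall x x', g x != 0 -> g x' != 0 -> y x = y x' -> x = x') ->
  (forall i : nat, (i < n)%N -> \sum_x g x * y x ^ (n0 + i%:Z) = 0) ->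
  (exists x, g x != 0) -> (n < #|[pred x | g x != 0%R]|)%N.
Proof.
move=> y0 inj mom [x0 gx0]; rewrite ltnNge; apply/negP => le_n.
pose p : {poly F} := \prod_(x in [pred x | (g x != 0) && (x != x0)]) ('X - (y x)%:P).
have sp : (size p <= n)%N.
  rewrite /p -big_enum size_prod_XsubC -cardE; apply: leq_trans le_n.
  rewrite [X in (_ <= X)%N](cardD1 x0) inE gx0 add1n ltnS; apply: eq_leq.
  by apply: eq_card => x; rewrite !inE andbC.
have : \sum_x g x * y x ^ n0 * p.[y x] = 0.
  under eq_bigr => x _ do rewrite (horner_coef_wide _ sp) mulr_sumr.
  rewrite exchange_big big1 //= => i _.
  transitivity (p`_i * \sum_x g x * y x ^ (n0 + i%:Z)); last by rewrite mom ?mulr0.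
  rewrite mulr_sumr; apply: eq_bigr => x _.
  by rewrite expfzDr // -exprnP; ring.
rewrite (bigD1 x0) //= big1 ?addr0 => [|x nx]; last first.
  have [->|gx] := eqVneq (g x) 0; first by rewrite !mul0r.
  suff -> : p.[y x] = 0 by rewrite mulr0.
  apply/eqP; rewrite /p horner_prod; apply/prodf_eq0; exists x; rewrite ?inE ?gx //.
  by rewrite hornerXsubC subrr.
move/eqP; rewrite !mulf_eq0 (negPf gx0) /= expfz_eq0 (negPf (y0 _)) andbF /=.
rewrite horner_prod => /prodf_eq0[x /andP[gx nx]].
rewrite hornerXsubC subr_eq0 => /eqP eq_y.
by rewrite (inj _ _ gx0 gx eq_y) eqxx in nx.
Qed.

End Interpolation.

Section LineValues.

(** Take for j the residue modulo b that makes n + j a divisible by b; the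
    hypotheses on n then place i between 0 and l. *)
Lemma line_values_pos (a b : int) (l : nat) (n : int) : coprimez a b -> 0 < b ->
  `|a| * b <= n -> n <= b * (l%:Z - `|a|) -> b <= l%:Z ->
  exists i j : nat, [/\ (i <= l)%N, (j <= l)%N & i%:Z * b - j%:Z * a = n].
Proof.
move=> co b0 n_lo n_hi b_le.
have [u [v uv]] := Bezoutz a b; rewrite (eqP co) in uv.
pose j := ((- n * u) %% b)%Z.
have b_neq0 : b != 0 by rewrite gt_eqF.
have j0 : 0 <= j by apply: modz_ge0.
have jb : j < b by apply: ltz_pmod.
have [i defi] : exists i, n + j * a = i * b.
  apply/dvdzP; rewrite (_ : n + j * a = n * v * b - ((- n * u) %/ b)%Z * a * b).
    by rewrite rpredB // dvdz_mull.
  have nE : n = n * u * a + n * v * b by rewrite -!mulrA -mulrDr uv mulr1.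
  by rewrite /j /modz; move: (_ %/ _)%Z => q; rewrite [X in X + _ = _]nE; ring.
have ja : `|j * a| <= b * `|a|.
  by rewrite normrM (ger0_norm j0) ler_wpM2r // ltW.
have ib0 : 0 <= i * b by rewrite -defi; lia.
have ibl : i * b <= l%:Z * b by rewrite -defi; lia.
have i0 : 0 <= i by move: ib0; rewrite pmulr_lge0.
have il : i <= l%:Z by move: ibl; rewrite ler_pM2r.
exists `|i|%N, `|j|%N; split; [lia | lia | rewrite !gez0_abs // -defi; ring].
Qed.

(** On the square of side l the form u b - v a ranges over an interval of length
    l (|a| + |b|), and it takes all integer values except near the ends. *)
Lemma line_values (a b : int) (l : nat) : coprimez a b ->
  let h := maxn `|a| `|b| in (2 * h <= l)%N ->
  exists n0 : int, forall i : nat, (i <= h * (l - 2 * h))%N ->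
    exists u v : nat, [/\ (u <= l)%N, (v <= l)%N & u%:Z * b - v%:Z * a = n0 + i%:Z].
Proof.
move=> co h le_h.
(* in each case the larger of the two coefficients plays the part of b, up to sign *)
have key (c d : int) : coprimez c d -> 0 < d -> (`|c| <= `|d|)%N -> h = `|d|%N ->
    forall i : nat, (i <= h * (l - 2 * h))%N ->
    (exists u v : nat, [/\ (u <= l)%N, (v <= l)%N &
       u%:Z * d - v%:Z * c = `|c|%:Z * d + i%:Z]) /\
    (exists u v : nat, [/\ (u <= l)%N, (v <= l)%N &
       u%:Z * d - v%:Z * c = d * (l%:Z - `|c|%:Z) - i%:Z]).
  move=> co' d0 cd hd i le_i.
  have le_i' : i%:Z + 2%:Z * (`|c|%:Z * d) <= d * l%:Z.
    have [e de] : exists e : nat, d = e%:Z by exists `|d|%N; rewrite gez0_abs // ltW.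
    move: cd hd le_i; rewrite de absz_nat => cd hd le_i; rewrite hd in le_i le_h.
    rewrite -!PoszM -PoszD lez_nat.
    apply: leq_trans (leq_add le_i (leqnn _)) _.
    rewrite mulnBr mulnA [(2 * _)%N]mulnC -!mulnA.
    have : (`|c| * (e * 2) <= e * (2 * e))%N.
      by rewrite mulnCA leq_mul2l mulnC leq_mul2l cd !orbT.
    have : (e * (2 * e) <= e * l)%N by rewrite leq_mul2l le_h orbT.
    lia.
  have b_le : d <= l%:Z by lia.
  by split; apply: line_values_pos => //; lia.
have co_neq0 : (a != 0) || (b != 0).
  by apply: contraTT co; rewrite negb_or !negbK => /andP[/eqP-> /eqP->].
have [le_ab|lt_ba] := leqP `|a| `|b|.
  have hb : h = `|b|%N by rewrite /h; apply/maxn_idPr.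
  have [b0|b0|b0] := ltgtP 0 b.
  - exists (`|a|%:Z * b) => i le_i.
    by have [] := key a b co b0 le_ab hb i le_i.
  - exists (- (- b * (l%:Z - `|a|%:Z))) => i le_i.
    have [||||_ [u [v [u_le v_le uv]]]] := key (- a) (- b) _ _ _ _ i le_i.
    + by rewrite /coprimez gcdNz gcdzN.
    + by rewrite oppr_gt0.
    + by rewrite !abszN.
    + by rewrite abszN.
    exists u, v; split=> //; rewrite abszN in uv; lia.
  - by move: co_neq0 le_ab; rewrite -b0; lia.
have ha : h = `|a|%N by rewrite /h; apply/maxn_idPl/ltnW.
have co' : coprimez b a by rewrite coprimez_sym.
have [a0|a0|a0] := ltgtP 0 a.
- exists (- (a * (l%:Z - `|b|%:Z))) => i le_i.
  have [_ [u [v [u_le v_le uv]]]] := key b a co' a0 (ltnW lt_ba) ha i le_i.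
  by exists v, u; split=> //; lia.
- exists (`|b|%:Z * - a) => i le_i.
  have [||||[u [v [u_le v_le uv]]] _] := key (- b) (- a) _ _ _ _ i le_i.
  + by rewrite /coprimez gcdNz gcdzN.
  + by rewrite oppr_gt0.
  + by rewrite !abszN ltnW.
  + by rewrite abszN.
  by exists v, u; split=> //; rewrite abszN in uv; lia.
- by move: lt_ba; rewrite -a0; lia.
Qed.

End LineValues.

(** * From a small support to a line *)

Section Dimension.
Variables (F : closedFieldType) (X : finType) (a b : X -> F).

(** There are more monomials of bidegree at most d than points to vanish at. *)
Lemma annihilator_exists (f : X -> F) (S : {set X}) d :
  (forall x, f x != 0 -> x \in S) -> (#|S| < d.+1 * d.+1)%N ->
  exists Q, [/\ Q != 0, bideg d Q & annihilates a b f Q].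
Proof.
move=> fS cS; pose I := ('I_d.+1 * 'I_d.+1)%type.
pose e (u : 'I_#|{: I}|) : I := enum_val u.
pose A : 'M[F]_(#|{: I}|, #|S|) :=
  \matrix_(u, x) (a (enum_val x) ^+ (e u).1 * b (enum_val x) ^+ (e u).2).
have : kermx A != 0.
  rewrite kermx_eq0 /row_free neq_ltn; apply/orP; left.
  by apply: leq_ltn_trans (rank_leq_col A) _; rewrite card_prod card_ord.
case/rowV0Pn => v /sub_kermxP vA v0.
pose c i j := v 0 (enum_rank (inord i : 'I_d.+1, inord j : 'I_d.+1)).
pose Q : {poly {poly F}} := \poly_(i < d.+1) \poly_(j < d.+1) c i j.
exists Q; split.
- apply: contraNneq v0 => Q0; apply/eqP/rowP => u; rewrite mxE.
  have /(congr1 (fun P : {poly {poly F}} => P`_(e u).1`_(e u).2)) := Q0.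
  rewrite /= !coef0 !coef_poly !ltn_ord coef_poly ltn_ord.
  by rewrite /c !inord_val -surjective_pairing enum_valK.
- apply/andP; split; first exact: size_poly.
  apply/bigmax_leqP => i _; rewrite coef_poly; case: ifP => _; last by rewrite size_poly0.
  exact: size_poly.
move=> x; rewrite /twist; have [->|fx] := eqVneq (f x) 0; first by rewrite mul0r.
have Sx := fS x fx; suff -> : Q.[a x, b x] = 0 by rewrite mulr0.
transitivity ((v *m A) 0 (enum_rank_in Sx x)); last by rewrite vA mxE.
rewrite mxE /Q [(\poly_(_ < _) _).[_]]horner_poly horner_sum.
under eq_bigr => i _.
  rewrite hornerM -polyC_exp hornerC horner_poly mulr_suml.
  over.
rewrite pair_bigA /= (reindex (@enum_val _ {: I})) /=; last first.
  exact/onW_bij/enum_val_bij.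
apply: eq_bigr => u _; rewrite /c !inord_val -surjective_pairing enum_valK !mxE.
by rewrite enum_rankK_in //; ring.
Qed.

End Dimension.

Section LineStructure.
Variables (M k : nat) (z : algC).
Hypothesis (M_gt0 : (0 < M)%N) (k_gt0 : (0 < k)%N).
Hypothesis (z_prim : (M ^ k).-primitive_root z).
Notation N := (M ^ k)%N.
Notation pt1 := (fun x : grid N => z ^+ x.1).
Notation pt2 := (fun x : grid N => z ^+ x.2).
Notation twist := (twist pt1 pt2).
Notation annihilates := (annihilates pt1 pt2).
Notation vanishing_moments := (vanishing_moments pt1 pt2).
Implicit Types (f g : grid N -> algC) (P Q T U : {poly {poly algC}}).

Definition moment f (xi : int * int) := \sum_x f x * z ^ (dot x xi).

Let z0 : z != 0.
Proof. by rewrite (prim_root_eq0 z_prim) -lt0n (prim_order_gt0 z_prim). Qed.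

Lemma vanishing_momentsE f L (u v : nat) : vanishing_moments f L ->
  (u <= L)%N -> (v <= L)%N -> moment f (u%:Z, v%:Z) = 0.
Proof.
move=> mom uL vL; rewrite -[RHS](mom ((1%:P * 'X^v)%:P * 'X^u)); last exact: bideg_monomial.
apply: eq_bigr => x _; rewrite horner2_monomial mul1r -!exprM -exprD exprnP.
by rewrite /dot /= PoszD !PoszM.
Qed.

Lemma moment_twist f U xi D : bideg D U ->
  moment (twist f U) xi = \sum_(u < D.+1) \sum_(v < D.+1)
    U`_u`_v * moment f (xi.1 + u%:Z, xi.2 + v%:Z).
Proof.
case/andP=> sU sYU.
have sYU' i : (size (U`_i)%R <= D.+1)%N := leq_trans (max_size_coefXY U i) sYU.
have evU x y : U.[x, y] = \sum_(u < D.+1) \sum_(v < D.+1) U`_u`_v * x ^+ u * y ^+ v.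
  rewrite (horner_coef_wide _ sU) horner_sum; apply: eq_bigr => i _.
  rewrite hornerM -polyC_exp hornerC (horner_coef_wide _ (sYU' i)) mulr_suml.
  by apply: eq_bigr => j _; rewrite mulrAC.
rewrite /moment /twist; under eq_bigr => x _ do rewrite evU mulr_sumr mulr_suml.
rewrite exchange_big /=; apply: eq_bigr => u _.
under eq_bigr => x _ do rewrite mulr_sumr mulr_suml.
rewrite exchange_big /=; apply: eq_bigr => v _.
rewrite mulr_sumr; apply: eq_bigr => x _.
have -> : dot x (xi.1 + u%:Z, xi.2 + v%:Z) = dot x xi + (x.1 * u)%:Z + (x.2 * v)%:Z.
  by rewrite /dot /= !PoszM; ring.
by rewrite !expfzDr // -!exprnP !exprM; ring.
Qed.

(** Chains the three multiplications: by a polynomial of bidegree d to get an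
    irreducible annihilator, by k M^2 d to reach the last level, and by M d to
    select one line. *)
Lemma twisted_to_line f (S : {set grid N}) d L :
  nonzero f -> (forall x, f x != 0 -> x \in S) -> (#|S| < d.+1 * d.+1)%N ->
  vanishing_moments f ((d + k * (M * M * d) + M * d) + (d + d) + L) ->
  exists (a b c : int) U, [/\ coprimez a b, (`|a| <= d)%N && (`|b| <= d)%N,
    bideg (d + k * (M * M * d) + M * d) U, nonzero (twist f U) &
    forall x, twist f U x != 0 -> on_line (a, b) c x].
Proof.
move=> f0 fS cS mom; set D := (M * M * d)%N in mom *.
have [Q0 [Q00 dQ0 fQ0]] := annihilator_exists pt1 pt2 fS cS.
have [U1 [Q [dU1 dQ irrQ fU1 fQ]]] := minimal_annihilator f0 Q00 dQ0 fQ0.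
have [|U2 [dU2 fU2 lev]] := @all_levels _ k _ M_gt0 z_prim _ Q d 0 irrQ dQ fQ fU1.
  by apply: twist_vanishing_moments dU1 _; apply: vanishing_momentsW mom; rewrite -/D; lia.
have [a [b [c [U3 [co bnd dU3 fU3 lin]]]]] :=
  separate_lines M_gt0 z_prim irrQ dQ (twist_annihilates U2 fQ) fU2 k_gt0 lev.
have twE : twist (twist (twist f U1) U2) U3 =1 twist f (U1 * U2 * U3).
  by move=> x; rewrite -twistM {1}/twist twistM.
exists a, b, c, (U1 * U2 * U3); split=> //.
- apply: bidegM dU3; apply: bidegM dU1 _; apply: bidegW dU2.
  by rewrite leq_mul2r leq_pred orbT.
- exact: eq_nonzero twE fU3.
- by move=> x; rewrite -twE; apply: lin.
Qed.

End LineStructure.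

(** * Functions supported on a discrete line *)

Section DiscreteLines.
Variables (N : nat) (a b s t : int).
Hypothesis bezout : s * a + t * b = 1.

(** (t, -s) and (a, b) form a basis of the lattice Z^2. As linear forms, the
    first is a coordinate along the lines x.(a,b) = c and the second is constant
    on them. *)
Lemma dot_bezout (x : grid N) xi : dot x xi =
  (xi.1 * b - xi.2 * a) * dot x (t, - s) + (xi.1 * s + xi.2 * t) * dot x (a, b).
Proof.
rewrite -[LHS]mulr1 -bezout /dot /=; ring.
Qed.

Lemma line_coordinate_inj (c : int) (x y : grid N) :
  on_line (a, b) c x -> on_line (a, b) c y ->
  (N%:Z %| dot x (t, - s) - dot y (t, - s))%Z -> x = y.
Proof.
move=> xl yl dw; have de : (N%:Z %| dot x (a, b) - dot y (a, b))%Z.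
  have -> : dot x (a, b) - dot y (a, b) = (dot x (a, b) - c) - (dot y (a, b) - c) by ring.
  exact: rpredB.
have small (m n : 'I_N) : (N%:Z %| (m : nat)%:Z - (n : nat)%:Z)%Z -> m = n.
  rewrite -eqz_mod_dvd !modz_nat !modn_small // => /eqP[mn]; exact: val_inj.
have E (m : int) : m = m * (s * a + t * b) by rewrite bezout mulr1.
apply: injective_projections; apply: small.
- rewrite [X in (_ %| X)%Z](_ : _ = s * (dot x (a, b) - dot y (a, b)) +
    b * (dot x (t, - s) - dot y (t, - s))).
    by rewrite rpredD // dvdz_mull.
  by rewrite [LHS]E /dot /=; ring.
- rewrite [X in (_ %| X)%Z](_ : _ = t * (dot x (a, b) - dot y (a, b)) -
    a * (dot x (t, - s) - dot y (t, - s))).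
    by rewrite rpredB // dvdz_mull.
  by rewrite [LHS]E /dot /=; ring.
Qed.

Lemma card_line (c : int) : (0 < N)%N ->
  (#|[set x : grid N | on_line (a, b) c x]| <= N)%N.
Proof.
move=> N_gt0; have N0 : N%:Z != 0 by rewrite eqz_nat -lt0n.
have lt_mod (m : int) : (`|(m %% N%:Z)%Z| < N)%N.
  rewrite -ltz_nat gez0_abs ?modz_ge0 //; apply: ltz_pmod.
  by rewrite ltz_nat.
pose w (x : grid N) := Ordinal (lt_mod (dot x (t, - s))).
have w_inj : {in [set x | on_line (a, b) c x] &, injective w}; last first.
  by rewrite -(card_in_imset w_inj) -[X in (_ <= X)%N]card_ord max_card.
move=> x y; rewrite !inE => xl yl /(congr1 val)/(congr1 Posz) /=.
rewrite !gez0_abs ?modz_ge0 // => /eqP; rewrite eqz_mod_dvd.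
exact: (line_coordinate_inj xl yl).
Qed.

End DiscreteLines.

Section LineStructure.
Variables (M k : nat) (z : algC).
Hypothesis (M_gt0 : (0 < M)%N) (k_gt0 : (0 < k)%N).
Hypothesis (z_prim : (M ^ k).-primitive_root z).
Notation N := (M ^ k)%N.
Notation pt1 := (fun x : grid N => z ^+ x.1).
Notation pt2 := (fun x : grid N => z ^+ x.2).
Notation twist := (twist pt1 pt2).
Notation vanishing_moments := (vanishing_moments pt1 pt2).
Notation moment := (moment z).
Implicit Types (f g : grid N -> algC) (P Q T U : {poly {poly algC}}).

Let z0 : z != 0.
Proof. by rewrite (prim_root_eq0 z_prim) -lt0n (prim_order_gt0 z_prim). Qed.

Section OneLine.
Variables (g : grid N -> algC) (a b c s t : int).
Hypotheses (bezout : s * a + t * b = 1) (g0 : nonzero g).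
Hypothesis g_line : forall x, g x != 0 -> on_line (a, b) c x.

Let y (x : grid N) := z ^ dot x (t, - s).

(** On a line, a character depends on the frequency xi only through
    xi.1 b - xi.2 a, up to a phase that does not depend on the point. *)
Lemma line_character x xi : g x != 0 -> z ^ dot x xi =
  y x ^ (xi.1 * b - xi.2 * a) * z ^ (c * (xi.1 * s + xi.2 * t)).
Proof.
have expC m : z ^ (N%:Z * m) = 1 by apply/eqP; rewrite (prim_exprz_eq1 _ z_prim) dvdz_mulr.
move=> /g_line/dvdzP[q dotE]; rewrite (dot_bezout bezout) expfzDr // /y exprz_exp.
have -> : dot x (a, b) = c + N%:Z * q by rewrite -[LHS](subrK c) dotE; ring.
rewrite [dot x (t, _) * _]mulrC; congr (_ * _); set B := _ + _.
have -> : B * (c + N%:Z * q) = c * B + N%:Z * (B * q) by ring.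
by rewrite expfzDr // expC mulr1.
Qed.

Lemma line_moment xi : moment g xi =
  z ^ (c * (xi.1 * s + xi.2 * t)) * \sum_x g x * y x ^ (xi.1 * b - xi.2 * a).
Proof.
rewrite mulr_sumr; apply: eq_bigr => x _.
have [->|gx] := eqVneq (g x) 0; first by rewrite !mul0r mulr0.
by rewrite line_character //; ring.
Qed.

Let y_neq0 x : y x != 0. Proof. exact: expfz_neq0. Qed.

Let y_inj x x' : g x != 0 -> g x' != 0 -> y x = y x' -> x = x'.
Proof.
move=> gx gx' yx; apply: (line_coordinate_inj bezout (g_line gx) (g_line gx')).
rewrite -(prim_exprz_eq1 _ z_prim) expfzDr // -invr_expz -/(y x) -/(y x') yx.
by rewrite mulfV.
Qed.

(** The frequencies (u, v) with u, v <= L give more than h (L - 2 h) consecutive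
    values of u b - v a ([line_values]), hence as many consecutive power sums of
    the distinct numbers y x, weighted by g x, which vanish. *)
Lemma line_support_count L (h := maxn `|a| `|b|) : (2 * h <= L)%N ->
  vanishing_moments g L -> (h * (L - 2 * h) < #|[pred x | g x != 0%R]|)%N.
Proof.
move=> hL mom; have co : coprimez a b.
  by apply/coprimezP; exists (s, t).
have [n0 n0P] := line_values co hL.
apply: ltnW; apply: (support_gt_vanishing_powers (n0 := n0) y_neq0 y_inj _ g0).
move=> i; rewrite ltnS => lt_i; have [u [v [uL vL uv]]] := n0P i lt_i.
have := vanishing_momentsE mom uL vL; rewrite line_moment /= uv => /eqP.
by rewrite mulf_eq0 expfz_eq0 (negPf z0) andbF => /eqP.
Qed.

(** By [line_moment] the vanishing of a moment depends only on
    xi.1 b - xi.2 a modulo N, and not all moments vanish. *)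
Lemma line_moment_neq0 : exists c' : int, forall xi : int * int,
  (N%:Z %| xi.1 * b - xi.2 * a - c')%Z -> moment g xi != 0.
Proof.
have expC x m : y x ^ (N%:Z * m) = 1.
  by rewrite /y exprz_exp; apply/eqP; rewrite (prim_exprz_eq1 _ z_prim) mulrCA dvdz_mulr.
have [[c' sum_c']|noc] := EM (exists c' : int, \sum_x g x * y x ^ c' != 0).
  exists c' => xi /dvdzP[q eq_xi]; rewrite line_moment mulf_neq0 ?expfz_neq0 //.
  rewrite -[xi.1 * b - _](subrK c') eq_xi.
  under eq_bigr => x _ do rewrite expfzDr // [q * _]mulrC expC mul1r.
  exact: sum_c'.
suff : (#|[pred x | g x != 0%R]| < #|[pred x | g x != 0%R]|)%N by rewrite ltnn.
apply: (support_gt_vanishing_powers (n0 := 0) y_neq0 y_inj _ g0) => i _.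
apply/eqP/negPn/negP => ne.
by apply: noc; exists (0 + i%:Z).
Qed.

End OneLine.

(** Multiplying f by a polynomial of bidegree D mixes each Fourier coefficient
    with those of frequency at most D further ([moment_twist]), so a line of
    nonzero moments of the product gives a line in the D-neighbourhood of the
    spectrum of f. The bound on h (L - 2 h) comes from the at most N points of a
    discrete line. *)
Theorem line_structure f (S : {set grid N}) d L :
  nonzero f -> (forall x, f x != 0 -> x \in S) -> (#|S| < d.+1 * d.+1)%N ->
  let D := (d + k * (M * M * d) + M * d)%N in
  vanishing_moments f (D + (d + d) + L) -> (2 * d <= L)%N ->
  exists a b : int, let h := maxn `|a| `|b| in
    [/\ coprimez a b, (h <= d)%N, (h * (L - 2 * h) < N)%N,
      exists c, (L - 2 * h < #|[set x in S | on_line (a, b) c x]|)%N &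
      exists c' : int, forall xi : int * int,
        (N%:Z %| xi.1 * b - xi.2 * a - c')%Z ->
        exists u v : nat, [/\ (u <= D)%N, (v <= D)%N &
          moment f (xi.1 + u%:Z, xi.2 + v%:Z) != 0]].
Proof.
move=> f0 fS cS D mom dL.
have [a [b [c [U [co /andP[ad bd] dU fU lin]]]]] :=
  twisted_to_line M_gt0 k_gt0 z_prim f0 fS cS mom.
have N_gt0 := prim_order_gt0 z_prim.
have hd : (maxn `|a| `|b| <= d)%N by rewrite geq_max ad bd.
have [s [t st]] := Bezoutz a b; rewrite (eqP co) in st.
have hL : (2 * maxn `|a| `|b| <= L)%N by apply: leq_trans dL; rewrite leq_mul2l hd.
have momL : vanishing_moments (twist f U) L.
  apply: twist_vanishing_moments dU _; apply: vanishing_momentsW mom.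
  by rewrite -/D -[X in (_ <= X)%N]addnA leq_add2l leq_addl.
have cnt := line_support_count st fU lin hL momL.
have h_gt0 : (0 < maxn `|a| `|b|)%N.
  rewrite leq_max !absz_gt0; apply: contraTT co.
  by rewrite negb_or !negbK => /andP[/eqP-> /eqP->].
have sub_line : (#|[pred x | twist f U x != 0%R]| <= #|[set x in S | on_line (a, b) c x]|)%N.
  apply: subset_leq_card; apply/fintype.subsetP => x; rewrite !inE => fx.
  apply/andP; split; last exact: lin.
  by apply: fS; apply: contraNneq fx => fx; rewrite /twist fx mul0r.
exists a, b => h; split=> //.
- apply: leq_trans cnt _; apply: leq_trans sub_line _.
  apply: leq_trans (card_line st c N_gt0); apply: subset_leq_card.
  by apply/fintype.subsetP => x; rewrite !inE => /andP[].
- exists c; apply: leq_trans sub_line; apply: leq_trans cnt.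
  by rewrite ltnS leq_pmull.
have [c' c'P] := line_moment_neq0 st fU lin.
exists c' => xi /c'P; rewrite (moment_twist z_prim _ _ dU) => ne.
apply: contrapT => none; case/eqP: ne; apply: big1 => u _; apply: big1 => v _.
have [->|nz] := eqVneq (moment f (xi.1 + (u : nat)%:Z, xi.2 + (v : nat)%:Z)) 0.
  by rewrite mulr0.
by case: none; exists u, v; split=> //; rewrite -ltnS.
Qed.

End LineStructure.

(** * Digits and Cantor iterates *)

Section Digits.
Variable M : nat.
Hypothesis M_gt0 : (0 < M)%N.

Definition digit n j : 'I_M := Ordinal (ltn_pmod (n %/ M ^ j) M_gt0).

Lemma expM_gt0 j : (0 < M ^ j)%N. Proof. by rewrite expn_gt0 M_gt0. Qed.

Lemma digit_expansion k n : (n < M ^ k)%N -> n = (\sum_(j < k) digit n j * M ^ j)%N.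
Proof.
elim: k n => [|k IHk] n; first by rewrite expn0 big_ord0; case: n.
move=> n_lt; rewrite big_ord_recr /= {1}(divn_eq n (M ^ k)) addnC; congr addn.
  rewrite {1}(IHk (n %% M ^ k)%N) ?ltn_mod ?expM_gt0 //; apply: eq_bigr => j _ /=.
  congr (_ * _)%N; have jk := ltn_ord j.
  have -> : (M ^ k = M ^ (k - j.+1) * M * M ^ j)%N by rewrite -expnSr -expnD; congr expn; lia.
  by rewrite -modn_divl ?expM_gt0 // modn_dvdm // dvdn_mull.
by rewrite modn_small // ltn_divLR ?expM_gt0 // -expnS.
Qed.

Lemma digit_low k a b j : (j < k)%N -> digit (a * M ^ k + b) j = digit b j.
Proof.
move=> jk; apply: val_inj => /=.
have -> : (M ^ k = M ^ (k - j.+1) * M * M ^ j)%N by rewrite -expnSr -expnD; congr expn; lia.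
by rewrite mulnA divnMDl ?expM_gt0 // mulnA modnMDl.
Qed.

Lemma digit_high k a b j : (b < M ^ k)%N -> digit (a * M ^ k + b) (k + j) = digit a j.
Proof.
move=> b_lt; apply: val_inj => /=.
by rewrite expnD divnMA divnMDl ?expM_gt0 // (divn_small b_lt) addn0.
Qed.

Lemma digit_sum_lt k (d : 'I_k -> 'I_M) : (\sum_(j < k) d j * M ^ j < M ^ k)%N.
Proof.
elim: k d => [|k IHk] d; first by rewrite big_ord0.
rewrite big_ord_recr /= expnS.
apply: leq_trans (_ : M ^ k + d ord_max * M ^ k <= _)%N.
  by rewrite ltn_add2r; apply: (IHk (fun j => d (widen_ord (leqnSn k) j))).
by rewrite -mulSn leq_mul2r ltn_ord orbT.
Qed.

Lemma digit_sum k (d : 'I_k -> 'I_M) (i : 'I_k) :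
  digit (\sum_(j < k) d j * M ^ j)%N i = d i.
Proof.
elim: k d i => [|k IHk] d i; first by case: i.
have lt_sum := digit_sum_lt (fun j => d (widen_ord (leqnSn k) j)).
rewrite big_ord_recr /= addnC.
have [ik|] := ltnP i k.
  rewrite digit_low // (IHk (fun j => d (widen_ord (leqnSn k) j)) (Ordinal ik)).
  by congr (d _); apply: val_inj.
move=> ki; have ik : i = (k + 0)%N :> nat by have := ltn_ord i; lia.
rewrite ik digit_high //; apply: val_inj => /=.
rewrite expn0 divn1 modn_small //; congr (d _ : nat); apply: val_inj => /=; lia.
Qed.

Definition digits_in (A : {set grid M}) k (n m : nat) :=
  [forall j : 'I_k, (digit n j, digit m j) \in A].

(** xi is a frequency modulo M^k, and the shift is one-sided because it comes
    from multiplication by a polynomial. *)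
Definition digits_within (A : {set grid M}) k D (xi : int * int) :=
  exists u v : nat, [/\ (u <= D)%N, (v <= D)%N &
    digits_in A k `|((xi.1 + u%:Z)%R %% (M ^ k)%N)%Z| `|((xi.2 + v%:Z)%R %% (M ^ k)%N)%Z|].

Lemma in_cantor_iterate (A : {set grid M}) k (x : grid (M ^ k)) :
  (x \in cantor_iterate A k) = digits_in A k x.1 x.2.
Proof.
rewrite inE; apply/existsP/forallP => [[d /and3P[/forallP dA /eqP x1 /eqP x2]] j|xA].
  rewrite x1 x2 (digit_sum (fun j => (d j).1)) (digit_sum (fun j => (d j).2)).
  by rewrite -surjective_pairing.
exists [ffun j : 'I_k => (digit x.1 j, digit x.2 j)]; apply/and3P; split.
- by apply/forallP => j; rewrite ffunE.
- rewrite {1}(digit_expansion (ltn_ord x.1)); apply/eqP.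
  by apply: eq_bigr => j _; rewrite ffunE.
- rewrite {1}(digit_expansion (ltn_ord x.2)); apply/eqP.
  by apply: eq_bigr => j _; rewrite ffunE.
Qed.

Lemma digits_in_cat (A : {set grid M}) k l a b a' b' :
  (b < M ^ k)%N -> (b' < M ^ k)%N ->
  digits_in A (k + l) (a * M ^ k + b) (a' * M ^ k + b') =
  digits_in A k b b' && digits_in A l a a'.
Proof.
move=> b_lt b'_lt; apply/forallP/andP => [xA|[/forallP bA /forallP aA] j].
  split; apply/forallP => j.
    by have := xA (widen_ord (leq_addr l k) j); rewrite /= !digit_low.
  by have := xA (rshift k j); rewrite /= !digit_high.
have [jk|kj] := ltnP j k; first by rewrite !digit_low //; apply: (bA (Ordinal jk)).
have jl : (j - k < l)%N by have := ltn_ord j; lia.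
have := aA (Ordinal jl) => /=.
by rewrite -(digit_high a _ b_lt) -(digit_high a' _ b'_lt) subnKC.
Qed.

Lemma card_cantor_iterate (A : {set grid M}) k : (#|cantor_iterate A k| <= #|A| ^ k)%N.
Proof.
pose phi (x : grid (M ^ k)) : {ffun 'I_k -> grid M} :=
  [ffun j : 'I_k => (digit x.1 j, digit x.2 j)].
have phi_inj : injective phi.
  move=> x y /ffunP xy; have xyj j := xy j; rewrite /phi in xyj.
  apply: injective_projections; apply: val_inj; rewrite /= [LHS](@digit_expansion k) //
    [RHS](@digit_expansion k) //; apply: eq_bigr => j _;
    by have := xyj j; rewrite !ffunE => -[e1 e2]; rewrite /= ?e1 ?e2.
rewrite -(card_imset _ phi_inj); apply: leq_trans (_ : #|ffun_on (mem A)| <= _)%N.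
  apply: subset_leq_card; apply/fintype.subsetP => _ /imsetP[x xX ->].
  apply/ffun_onP => j; rewrite ffunE.
  by move: xX; rewrite in_cantor_iterate => /forallP.
by rewrite card_ffun_on card_ord.
Qed.

End Digits.

(** * Rank does not depend on the root of unity *)

Section Transfer.
Variables (F : numFieldType) (N : nat) (w : F) (z : algC).
Hypotheses (w_prim : N.-primitive_root w) (z_prim : N.-primitive_root z).

Lemma root_Cyclotomic : root (map_poly intr 'Phi_N) w.
Proof.
have N_gt0 := prim_order_gt0 w_prim.
have : root (map_poly intr (\prod_(d <- divisors N) 'Phi_d)) w.
  rewrite prod_Cyclotomic // rmorphB /= map_polyXn rmorph1 rootE !hornerE.
  by rewrite (prim_expr_order w_prim) subrr.
rewrite rmorph_prod /= /root horner_prod prodf_seq_eq0 => /hasP[d].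
rewrite -dvdn_divisors // => dN /= Phi_d; have d_gt0 := dvdn_gt0 N_gt0 dN.
suff : w ^+ d == 1.
  rewrite -(prim_order_dvd w_prim) => Nd; rewrite [X in 'Phi_X](_ : N = d) //.
  by apply/eqP; rewrite eqn_dvd dN Nd.
have : root (map_poly intr (\prod_(e <- divisors d) 'Phi_e)) w.
  rewrite rmorph_prod /= /root horner_prod prodf_seq_eq0; apply/hasP.
  by exists d => //; rewrite -dvdn_divisors.
by rewrite prod_Cyclotomic // rmorphB /= map_polyXn rmorph1 rootE !hornerE subr_eq0.
Qed.

(** The cyclotomic polynomial is irreducible over the rationals and has w as a
    root, so all relations with integer coefficients satisfied by w are
    satisfied by z. *)
Lemma root_int_poly_transfer (p : {poly int}) :
  root (map_poly intr p) w -> root (map_poly intr p) z.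
Proof.
move=> pw; apply/negPn/negP => pz.
have [m [minz m_monic] mP] := minCpolyP z.
pose q : {poly rat} := map_poly intr p.
have qC (K : numFieldType) : map_poly ratr q = map_poly intr p :> {poly K}.
  by rewrite -map_poly_comp; apply: eq_map_poly => c /=; rewrite ratr_int.
have mE : m = map_poly intr 'Phi_N.
  apply: (map_inj_poly (fmorph_inj (ratr : {rmorphism rat -> algC})) (rmorph0 _)).
  rewrite -minz (minCpoly_cyclotomic z_prim) -(Cintr_Cyclotomic z_prim).
  by rewrite -map_poly_comp; apply: eq_map_poly => c /=; rewrite ratr_int.
have mw : root (map_poly ratr m) w.
  rewrite mE -map_poly_comp (eq_map_poly (g := intr)) ?root_Cyclotomic //.
  by move=> c /=; rewrite ratr_int.
have m0 : m != 0 by rewrite monic_neq0.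
have : coprimep q m.
  rewrite coprimep_sym; apply/coprimepP => d dm dq.
  have /dvdpP[e defm] := dm.
  have : root (map_poly ratr m) z by rewrite mP.
  rewrite defm rmorphM rootM => /orP[]; rewrite mP => /dvdpP[h defh].
    have h0 : d * h = 1.
      apply: (mulIf m0); rewrite mul1r [RHS]defm defh; ring.
    by rewrite -size_poly_eq1 -dvdp1 -h0 dvdp_mulIl.
  case/negP: pz; rewrite -qC mP; apply: dvdp_trans dq.
  by apply/dvdpP; exists h.
case/Bezout_coprimepP => -[u v] /= /eqp_size.
rewrite size_poly1 => /eqP/size_poly1P[c c0 uv].
have := congr1 (fun P => (map_poly ratr P).[w]) uv.
rewrite /= rmorphD !rmorphM hornerD !hornerM /= qC (rootP pw) (rootP mw) !mulr0 addr0.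
by rewrite map_polyC hornerC /= => /esym/eqP; rewrite fmorph_eq0 (negPf c0).
Qed.

(** A nonzero maximal minor is the value at z of a polynomial with integer
    coefficients, and stays nonzero at w. *)
Lemma row_free_exp_transfer (m n : nat) (E : 'I_m -> 'I_n -> nat) :
  row_free (\matrix_(i, j) z ^+ E i j) -> row_free (\matrix_(i, j) w ^+ E i j).
Proof.
move=> free_z; set A := \matrix_(i, j) _ in free_z.
have fullT : row_full A^T by rewrite /row_full mxrank_tr.
pose g := fullrankfun fullT.
pose P : 'M[{poly int}]_m := \matrix_(i, j) 'X^(E i (g j)).
have detE (K : numFieldType) (x : K) :
    (map_poly intr (\det P)).[x] = \det (\matrix_(i, j) x ^+ E i (g j)).
  rewrite -[_.[x]]/(horner_eval x (map_poly intr (\det P))).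
  rewrite -!det_map_mx; congr (\det _); apply/matrixP => i j; rewrite !mxE /=.
  by rewrite map_polyXn /horner_eval hornerXn.
have : \det (\matrix_(i, j) z ^+ E i (g j)) != 0.
  rewrite -unitfE -unitmxE -unitmx_tr -row_full_unit.
  have := fullrowsub_full fullT; congr (row_full _ : Prop).
  by apply/matrixP => i j; rewrite !mxE.
rewrite -detE => detz; have {detz}: (map_poly intr (\det P)).[w] != 0.
  by apply: contraNN detz; apply: root_int_poly_transfer.
rewrite detE => detw.
rewrite -row_leq_rank
  -[X in (X <= _)%N](_ : \rank (\matrix_(i < m, j < m) w ^+ E i (g j)) = m).
  rewrite -mxrank_tr -[X in (_ <= X)%N]mxrank_tr.
  rewrite [X in (\rank X <= _)%N](_ : _ = rowsub g (\matrix_(i, j) w ^+ E i j)^T).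
    exact: (mxrankS (rowsub_sub _ _)).
  by apply/matrixP => i j; rewrite !mxE.
by apply/eqP; rewrite -[_ == _]/(row_free _) row_free_unit unitmxE unitfE.
Qed.

End Transfer.

(** * The discrete Fourier transform *)

Section Exponential.
Variable R : realType.
Notation C := R[i].

Lemma expiD (s t : R) : expi (s + t) = expi s * expi t.
Proof.
apply/eqP; rewrite eq_complex /= cosD sinD eqxx /=; apply/eqP; ring.
Qed.

Lemma expi0 : expi 0 = 1 :> C.
Proof. by rewrite /expi cos0 sin0. Qed.

Lemma expiMn (t : R) n : expi (t *+ n) = expi t ^+ n.
Proof.
by elim: n => [|n IHn]; rewrite ?mulr0n ?expi0 // mulrS exprS expiD IHn.
Qed.

Lemma expi_eq1 (t : R) : 0 < t < pi *+ 2 -> expi t != 1.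
Proof.
move=> /andP[t0 t2pi]; apply/negP => /eqP/(congr1 (@complex.Re R)) /=.
have -> : t = t / 2 *+ 2 by rewrite -mulr_natr divfK.
rewrite cos_mulr2n cos2sin2 => /eqP.
have : 0 < sin (t / 2).
  apply: sin_gt0_pi; rewrite divr_gt0 //= ltr_pdivrMr // mulr_natr; exact: t2pi.
move=> s0; have : 0 < sin (t / 2) ^+ 2 by rewrite exprn_gt0.
move: (sin _ ^+ 2) => e e0 /eqP; lra.
Qed.

Definition zeta N : C := expi (- (2 * pi / N%:R)).

Lemma zetaE N (m : nat) : expi (- (2 * pi / N%:R * m%:R)) = zeta N ^+ m :> C.
Proof. by rewrite /zeta -expiMn -mulNr mulr_natr. Qed.

Lemma zeta_order N : (0 < N)%N -> zeta N ^+ N = 1.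
Proof.
move=> N0; rewrite -zetaE divfK ?pnatr_eq0 -?lt0n //.
by rewrite /expi cosN sinN mulr_natl cos2pi sin2pi oppr0.
Qed.

Lemma zeta_exp N m : (0 < N)%N -> (0 < m)%N -> zeta (m * N) ^+ m = zeta N.
Proof.
move=> N0 m0; rewrite -zetaE /zeta natrM; congr (expi (- _)).
rewrite -mulrA; congr (_ * _).
by rewrite invfM mulrAC mulVf ?mul1r // pnatr_eq0 -lt0n.
Qed.

Lemma zeta_prim N : (0 < N)%N -> N.-primitive_root (zeta N).
Proof.
move=> N0; have [m m_prim mN] := prim_order_exists N0 (zeta_order N0).
rewrite [X in X.-primitive_root _](_ : N = m) //; apply/eqP.
rewrite eqn_leq (dvdn_leq N0 mN) andbT.
have m0 := prim_order_gt0 m_prim; rewrite leqNgt; apply/negP => ltm.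
have : expi (2 * pi / N%:R * m%:R) != 1 :> C.
  have pi0 := pi_gt0 R.
  apply: expi_eq1; apply/andP; split.
    by rewrite !mulr_gt0 ?invr_gt0 ?ltr0n.
  rewrite mulrAC ltr_pdivrMr ?ltr0n // -[X in X * N%:R]mulr_natl.
  by rewrite ltr_pM2l ?mulr_gt0 // ltr_nat.
have zm := prim_expr_order m_prim; rewrite -zetaE in zm.
case/eqP; transitivity (expi (2 * pi / N%:R * m%:R) * expi (- (2 * pi / N%:R * m%:R)) : C).
  by rewrite zm mulr1.
by rewrite -expiD subrr expi0.
Qed.

Definition nsq (w : C) : R := ComplexField.Normc.normc w ^+ 2.

Lemma nsqE (w : C) : nsq w = complex.Re w ^+ 2 + complex.Im w ^+ 2.
Proof. by case: w => a b; rewrite /nsq /= sqr_sqrtr // addr_ge0 ?sqr_ge0. Qed.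

Lemma nsq_ge0 w : 0 <= nsq w. Proof. exact: sqr_ge0. Qed.

Lemma nsqM v w : nsq (v * w) = nsq v * nsq w.
Proof. by rewrite /nsq ComplexField.Normc.normcM exprMn. Qed.

Lemma nsq0 : nsq 0 = 0.
Proof. by rewrite nsqE /= !expr0n addr0. Qed.

(** Moves identities between real square moduli to the complex field, where
    sums of characters can be expanded. *)
Lemma nsq_conj (w : C) : real_complex R (nsq w) = w * conjc w.
Proof.
rewrite nsqE; case: w => a b; apply/eqP; rewrite eq_complex /=.
by apply/andP; split; apply/eqP; ring.
Qed.

Lemma nsq_expi t : nsq (expi t) = 1.
Proof. by rewrite nsqE /= cos2Dsin2. Qed.

Lemma nsq_zeta N m : nsq (zeta N ^+ m) = 1.
Proof. by rewrite -expiMn nsq_expi. Qed.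

Lemma conj_zeta N m : conjc (zeta N ^+ m) = (zeta N ^+ m)^-1.
Proof.
have : zeta N ^+ m * conjc (zeta N ^+ m) = 1 by rewrite -nsq_conj nsq_zeta.
move=> h; apply: (mulfI (x := zeta N ^+ m)).
  by apply/negP => /eqP h0; move: h; rewrite h0 mul0r => /eqP; rewrite eq_sym oner_eq0.
rewrite h mulfV //; apply/negP => /eqP h0; move: h; rewrite h0 mul0r.
by move=> /eqP; rewrite eq_sym oner_eq0.
Qed.

Lemma zeta_orthogonality N (a b : 'I_N) : (0 < N)%N ->
  \sum_(j < N) zeta N ^+ (a * j) / zeta N ^+ (b * j) = (N * (a == b))%:R.
Proof.
move=> N0; have z_prim := zeta_prim N0.
have z0 m : zeta N ^+ m != 0 by rewrite expf_neq0 // (prim_root_eq0 z_prim) -lt0n.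
under eq_bigr => j _ do rewrite !exprM -expr_div_n.
have [->|ne] := eqVneq a b.
  by under eq_bigr => j _ do rewrite divff // expr1n; rewrite sumr_const card_ord muln1.
rewrite muln0; set u := _ / _.
have u1 : u != 1.
  apply: contra ne => /eqP u1; have /eqP : zeta N ^+ a = zeta N ^+ b.
    by rewrite -[LHS](divfK (z0 b)) -/u u1 mul1r.
  by rewrite (eq_prim_root_expr z_prim) !modn_small.
apply/eqP; rewrite -(mulrI_eq0 _ (mulfI (_ : u - 1 != 0))) ?subr_eq0 //.
rewrite -subrX1 expr_div_n -!exprM !(mulnC _ N) !exprM (prim_expr_order z_prim).
by rewrite !expr1n divff ?oner_eq0 ?subrr.
Qed.

End Exponential.

Section Plancherel.
Variable R : realType.
Notation C := R[i].

Lemma dftE N (f : {ffun grid N -> C}) xi :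
  dft f xi = N%:R^-1 * \sum_x f x * zeta R N ^+ (x.1 * xi.1 + x.2 * xi.2).
Proof. by rewrite ffunE; congr (_ * _); apply: eq_bigr => x _; rewrite zetaE. Qed.

Lemma zeta_orthogonality2 N (x y : grid N) : (0 < N)%N ->
  \sum_(xi : grid N) zeta R N ^+ (x.1 * xi.1 + x.2 * xi.2) /
    zeta R N ^+ (y.1 * xi.1 + y.2 * xi.2) = (N * N * (x == y))%:R.
Proof.
move=> N0; under eq_bigr => xi _ do rewrite !exprD invfM mulrACA.
rewrite -(pair_bigA _ (fun i j : 'I_N => zeta R N ^+ (x.1 * i) / zeta R N ^+ (y.1 * i) *
  (zeta R N ^+ (x.2 * j) / zeta R N ^+ (y.2 * j)))) /=.
under eq_bigr => i _ do rewrite -mulr_sumr zeta_orthogonality //.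
by rewrite -mulr_suml zeta_orthogonality // -natrM mulnACA mulnb.
Qed.

Lemma nsq_sum (I : finType) (F : I -> C) :
  real_complex R (nsq (\sum_i F i)) = \sum_i \sum_j F i * conjc (F j).
Proof.
by rewrite nsq_conj mulr_suml rmorph_sum; apply: eq_bigr => i _; rewrite mulr_sumr.
Qed.

Lemma plancherel N (f : {ffun grid N -> C}) : (0 < N)%N ->
  \sum_xi nsq (dft f xi) = \sum_x nsq (f x).
Proof.
move=> N0.
have Nn0 : N%:R != 0 :> C by rewrite pnatr_eq0 -lt0n.
have nsqN : nsq (N%:R^-1 : C) * (N * N)%:R = 1.
  apply: complexI; rewrite rmorphM /= nsq_conj conjc_inv conjc_nat rmorph_nat natrM.
  by rewrite -invfM mulVf // mulf_neq0.
under eq_bigr => xi _ do rewrite dftE nsqM.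
rewrite -mulr_sumr -[RHS]mul1r -nsqN -mulrA; congr (_ * _).
apply: complexI; rewrite rmorph_sum /=.
under eq_bigr => xi _ do rewrite nsq_sum.
rewrite exchange_big rmorphM rmorph_nat rmorph_sum mulr_sumr /=; apply: eq_bigr => x _.
rewrite exchange_big (bigD1 x) //= [X in _ + X]big1 ?addr0 => [|y nyx].
  transitivity (f x * conjc (f x) * \sum_(xi : grid N) zeta R N ^+ (x.1 * xi.1 + x.2 * xi.2) /
    zeta R N ^+ (x.1 * xi.1 + x.2 * xi.2)).
    rewrite mulr_sumr; apply: eq_bigr => xi _; rewrite rmorphM /= conj_zeta.
    by rewrite mulrACA.
  by rewrite zeta_orthogonality2 // eqxx muln1 nsq_conj mulrC.
transitivity (f x * conjc (f y) * \sum_(xi : grid N) zeta R N ^+ (x.1 * xi.1 + x.2 * xi.2) /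
  zeta R N ^+ (y.1 * xi.1 + y.2 * xi.2)).
  rewrite mulr_sumr; apply: eq_bigr => xi _; rewrite rmorphM /= conj_zeta.
  by rewrite mulrACA.
by rewrite zeta_orthogonality2 // eq_sym (negPf nyx) muln0 mulr0.
Qed.

End Plancherel.

(** * Submultiplicativity *)

Section GridSplit.

Lemma sum_nat_mul (V : nmodType) (m n : nat) (F : nat -> V) :
  \sum_(i < m * n) F i = \sum_(a < m) \sum_(b < n) F (a * n + b)%N.
Proof.
elim: m => [|m IHm]; first by rewrite !big_ord0.
rewrite big_ord_recr /= -IHm -!(big_mkord xpredT) mulSn addnC.
rewrite (big_cat_nat (n := (m * n)%N)) ?leq_addr //=; congr (_ + _).
rewrite -[X in \sum_(X <= _ < _) _]add0n big_addn addKn.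
by rewrite big_mkord; apply: eq_bigr => i _; rewrite addnC.
Qed.

Definition clip N (N_gt0 : (0 < N)%N) (n : nat) : 'I_N := Ordinal (ltn_pmod n N_gt0).

Lemma clip_ord N (N_gt0 : (0 < N)%N) (i : 'I_N) : clip N_gt0 i = i.
Proof. by apply: val_inj; rewrite /= modn_small. Qed.

Variables (m n N : nat) (N_gt0 : (0 < N)%N).
Hypothesis defN : N = (m * n)%N.

(** High digits a, low digits b. The number is reduced modulo N only to get an
    ordinal: it is already smaller than N ([join_lt]). *)
Definition join (a : grid m) (b : grid n) : grid N :=
  (clip N_gt0 (a.1 * n + b.1), clip N_gt0 (a.2 * n + b.2)).

Lemma join_lt (a : 'I_m) (b : 'I_n) : (a * n + b < N)%N.
Proof.
rewrite defN; apply: leq_trans (_ : (a.+1 * n <= _)%N); last by rewrite leq_mul2r ltn_ord orbT.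
by rewrite mulSn addnC ltn_add2r.
Qed.

Lemma join1 a b : (join a b).1 = (a.1 * n + b.1)%N :> nat.
Proof. by rewrite /= modn_small // join_lt. Qed.

Lemma join2 a b : (join a b).2 = (a.2 * n + b.2)%N :> nat.
Proof. by rewrite /= modn_small // join_lt. Qed.

Lemma sum_grid_join (V : nmodType) (F : grid N -> V) :
  \sum_x F x = \sum_(a : grid m) \sum_(b : grid n) F (join a b).
Proof.
pose G i j := F (clip N_gt0 i, clip N_gt0 j).
transitivity (\sum_(i < N) \sum_(j < N) G i j).
  by rewrite pair_bigA; apply: eq_bigr => -[i j] _; rewrite /G /= !clip_ord.
rewrite [in LHS]defN (sum_nat_mul m n (fun i => \sum_(j < m * n) G i j)).
under eq_bigr => a _.
  under eq_bigr => b _ do rewrite sum_nat_mul.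
  rewrite exchange_big /=; over.
rewrite pair_bigA; apply: eq_bigr => a _; rewrite pair_bigA; exact: eq_bigr.
Qed.

End GridSplit.

Section TwoScale.
Variables (R : realType) (m n N : nat) (N_gt0 : (0 < N)%N).
Hypotheses (defN : N = (m * n)%N) (defN' : N = (n * m)%N).
Notation C := R[i].

(** Write x = a n + b and xi = c m + d with N = m n. Modulo N the product x xi is
    n a d + b d + m b c: a transform in a at frequency d, a phase depending on b
    and d, a transform in b at frequency c. The two coordinates behave alike. *)
Lemma dft_join (f : {ffun grid N -> C}) (c : grid n) (d : grid m) :
  dft f (join N_gt0 c d) =
  dft [ffun b : grid n => zeta R N ^+ (b.1 * d.1 + b.2 * d.2) *
    dft [ffun a : grid m => f (join N_gt0 a b)] d] c.
Proof.
have [m0 n0] : (0 < m)%N /\ (0 < n)%N by apply/andP; rewrite -muln_gt0 -defN.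
have key (a : grid m) (b : grid n) :
    zeta R N ^+ ((join N_gt0 a b).1 * (join N_gt0 c d).1 +
                 (join N_gt0 a b).2 * (join N_gt0 c d).2) =
    zeta R N ^+ (b.1 * d.1 + b.2 * d.2) * zeta R m ^+ (a.1 * d.1 + a.2 * d.2) *
    zeta R n ^+ (b.1 * c.1 + b.2 * c.2).
  have -> : zeta R m = zeta R N ^+ n by rewrite defN' zeta_exp.
  have -> : zeta R n = zeta R N ^+ m by rewrite defN zeta_exp.
  rewrite !(join1 _ defN) !(join2 _ defN) !(join1 _ defN') !(join2 _ defN').
  rewrite -!exprM -!exprD.
  rewrite (_ : (_ + _)%N = (N * (a.1 * c.1 + a.2 * c.2) + ((b.1 * d.1 + b.2 * d.2) +
    n * (a.1 * d.1 + a.2 * d.2) + m * (b.1 * c.1 + b.2 * c.2)))%N); last by rewrite defN; ring.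
  by rewrite exprD exprM zeta_order // expr1n mul1r.
rewrite [LHS]dftE [RHS]dftE (sum_grid_join N_gt0 defN) exchange_big /=.
have -> : N%:R^-1 = n%:R^-1 * m%:R^-1 :> C by rewrite -invfM -natrM -defN'.
rewrite -mulrA mulr_sumr; congr (_ * _); apply: eq_bigr => b _; rewrite ffunE dftE.
rewrite !mulr_sumr mulr_suml; apply: eq_bigr => a _; rewrite ffunE key.
ring.
Qed.

End TwoScale.

Section Energy.
Variables (R : realType) (M : nat) (M_gt0 : (0 < M)%N) (A B : {set grid M}).
Notation C := R[i].
Notation XA k := (cantor_iterate A k).
Notation YB k := (cantor_iterate B k).

(** The squared operator norm of the transform cut off to X_k and Y_k is at most
    c. Squared norms are real sums, which spares square roots until
    [opnorm_le]. *)
Definition energy_bound k (c : R) := forall f : {ffun grid (M ^ k) -> C},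
  (forall x, x \notin XA k -> f x = 0) ->
  \sum_(xi in YB k) nsq (dft f xi) <= c * \sum_x nsq (f x).

Let gt0 k : (0 < M ^ k)%N. Proof. by rewrite expn_gt0 M_gt0. Qed.

Lemma join_in_cantor_iterate (S : {set grid M}) k l (N_gt0 : (0 < M ^ (k + l))%N)
    (defN : (M ^ (k + l) = M ^ l * M ^ k)%N)
    (a : grid (M ^ l)) (b : grid (M ^ k)) :
  (join N_gt0 a b \in cantor_iterate S (k + l)) =
  (b \in cantor_iterate S k) && (a \in cantor_iterate S l).
Proof.
by rewrite !(in_cantor_iterate M_gt0) (join1 _ defN) (join2 _ defN) digits_in_cat.
Qed.

(** As [join_in_cantor_iterate], for frequencies, where the scales play exchanged
    parts: k is the length of the high digits and l that of the low ones. *)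
Lemma join_in_cantor_iterate' (S : {set grid M}) k l (N_gt0 : (0 < M ^ (k + l))%N)
    (defN : (M ^ (k + l) = M ^ k * M ^ l)%N)
    (c : grid (M ^ k)) (d : grid (M ^ l)) :
  (join N_gt0 c d \in cantor_iterate S (k + l)) =
  (d \in cantor_iterate S l) && (c \in cantor_iterate S k).
Proof.
by rewrite !(in_cantor_iterate M_gt0) (join1 _ defN) (join2 _ defN) addnC digits_in_cat.
Qed.

(** Apply [dft_join]. For each low part of the frequency, the bound at scale k
    applies to a function of the low digits whose values are, up to phases of
    modulus 1, transforms at scale l of the slices of f; these are controlled by
    the bound at scale l. *)
Lemma energy_bound_add k l c d : 0 <= c -> energy_bound k c -> energy_bound l d ->
  energy_bound (k + l) (c * d).
Proof.
move=> c0 Ek El f fX.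
have defN : (M ^ (k + l) = M ^ l * M ^ k)%N by rewrite expnD mulnC.
have defN' : (M ^ (k + l) = M ^ k * M ^ l)%N by rewrite expnD.
pose fb (b : grid (M ^ k)) := [ffun a : grid (M ^ l) => f (join (gt0 (k + l)) a b)].
have fb0 b : b \notin XA k -> fb b = 0.
  move=> nb; apply/ffunP => a; rewrite !ffunE fX //.
  by rewrite (join_in_cantor_iterate _ _ defN) (negPf nb).
have fbX b a : a \notin XA l -> fb b a = 0.
  move=> na; rewrite ffunE fX //.
  by rewrite (join_in_cantor_iterate _ _ defN) (negPf na) andbF.
have dft0 (xi : grid (M ^ l)) : dft (0 : {ffun grid (M ^ l) -> C}) xi = 0.
  by rewrite dftE big1 ?mulr0 // => x _; rewrite ffunE mul0r.
rewrite big_mkcond (sum_grid_join (gt0 (k + l)) defN') exchange_big /=.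
apply: (@le_trans _ _ (\sum_(d0 in YB l) c * \sum_b nsq (dft (fb b) d0))).
  rewrite [X in _ <= X]big_mkcond; apply: ler_sum => xi _.
  under eq_bigr => c' _ do rewrite (join_in_cantor_iterate' _ _ defN') dft_join //.
  case: ifP => xiY /=; last by rewrite big1.
  rewrite -big_mkcond /=; apply: le_trans (Ek _ _) _.
    by move=> b nb; rewrite ffunE -/(fb b) fb0 // dft0 mulr0.
  rewrite ler_wpM2l //; apply: ler_sum => b _.
  by rewrite ffunE nsqM nsq_zeta mul1r.
rewrite -mulr_sumr -mulrA ler_wpM2l // exchange_big (sum_grid_join (gt0 (k + l)) defN).
rewrite [X in _ <= _ * X]exchange_big mulr_sumr /=; apply: ler_sum => b _.
apply: le_trans (El _ (fbX b)) _; rewrite le_eqVlt; apply/orP; left; apply/eqP.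
by congr (_ * _); apply: eq_bigr => a _; rewrite ffunE.
Qed.

Lemma energy_bound1 k : energy_bound k 1.
Proof.
move=> f _; rewrite mul1r -(plancherel f (gt0 k)) big_mkcond.
by apply: ler_sum => xi _; case: ifP => // _; apply: nsq_ge0.
Qed.

Lemma energy_bound_iter k c n r : 0 <= c -> energy_bound k c ->
  energy_bound (n * k + r) (c ^+ n).
Proof.
move=> c0 Ek; elim: n => [|n IHn]; first exact: energy_bound1.
by rewrite mulSn -addnA exprS; apply: energy_bound_add.
Qed.

Lemma opnorm_le k c : 0 <= c -> energy_bound k (c ^+ 2) ->
  opnorm (indic_mul (YB k) \o @dft R (M ^ k) \o indic_mul (XA k)) <= c.
Proof.
move=> c0 Ek; apply: ge_sup.
  exists (l2norm ((indic_mul (YB k) \o @dft R (M ^ k) \o indic_mul (XA k)) 0)), 0 => //.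
  rewrite /= /l2norm big1 ?sqrtr0 // => x _.
  by rewrite ffunE -/(nsq _) nsq0.
move=> _ [f /= f1 <-].
have sumf : \sum_x nsq (f x) <= 1.
  rewrite -(sqr_sqrtr (sumr_ge0 _ (fun x _ => nsq_ge0 (f x)))).
  by rewrite exprn_ile1 ?sqrtr_ge0.
rewrite /l2norm -(ger0_norm c0) -sqrtr_sqr ler_sqrt ?sqr_ge0 //.
apply: (@le_trans _ _ (\sum_(xi in YB k) nsq (dft (indic_mul (XA k) f) xi))).
  rewrite [X in _ <= X]big_mkcond; apply: ler_sum => xi _; rewrite ffunE.
  by case: ifP => // _; rewrite -/(nsq _) nsq0.
apply: le_trans (Ek _ _) _; first by move=> x nx; rewrite ffunE (negPf nx).
rewrite -[X in _ <= X]mulr1 ler_wpM2l ?sqr_ge0 //; apply: le_trans sumf.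
apply: ler_sum => x _; rewrite ffunE; case: ifP => // _.
by rewrite nsq0 nsq_ge0.
Qed.

End Energy.

(** * Spectral gap and exponential decay *)

Section SpectralGap.
Variable R : realType.
Notation C := R[i].

Lemma nsqD_le (v w : C) : nsq (v + w) <= 2 * nsq v + 2 * nsq w.
Proof.
rewrite !nsqE; case: v w => a b [c d] /=.
have := sqr_ge0 (a - c); have := sqr_ge0 (b - d); nra.
Qed.

(** The constant is crude; any constant depending only on the number of terms
    would do for the spectral gap. *)
Lemma nsq_sum_le (I : Type) (s : seq I) (F : I -> C) :
  nsq (\sum_(i <- s) F i) <= 2 ^+ size s * \sum_(i <- s) nsq (F i).
Proof.
elim: s => [|i s IHs]; first by rewrite !big_nil nsq0 mulr0.
rewrite !big_cons exprS; apply: le_trans (nsqD_le _ _) _.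
rewrite -mulrA -mulrDr ler_pM2l // mulrDr lerD // -[X in X <= _]mul1r.
by rewrite ler_wpM2r ?nsq_ge0 // exprn_ege1 // ler1n.
Qed.

Variables (M : nat) (M_gt0 : (0 < M)%N) (A B : {set grid M}) (k : nat).
Notation N := (M ^ k)%N.
Notation XA := (cantor_iterate A k).
Notation YB := (cantor_iterate B k).
Variable z : algC.
Hypothesis z_prim : N.-primitive_root z.

(** The transform is written with a primitive root z in the algebraic numbers
    instead of the complex exponential. *)
Definition extremizer (f : grid N -> algC) := [/\ exists x, f x != 0,
  forall x, x \notin XA -> f x = 0 &
  forall xi, xi \notin YB -> \sum_x f x * z ^+ (x.1 * xi.1 + x.2 * xi.2) = 0].

(** Without extremizers, the matrix W from functions on X_k to the Fourier
    coefficients outside Y_k has independent rows, over the algebraic numbers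
    and then over the complex field by [row_free_exp_transfer]. A right inverse
    V bounds the energy of f by K times the energy of its transform outside Y_k,
    which leaves at most the proportion 1 - 1/K inside by Plancherel. *)
Lemma spectral_gap : (forall f, ~ extremizer f) ->
  exists2 rho : R, 0 <= rho < 1 & energy_bound A B k rho.
Proof.
move=> noext; have N0 : (0 < N)%N by rewrite expn_gt0 M_gt0.
pose m := #|XA|; pose n := #|~: YB|.
pose E (i : 'I_m) (j : 'I_n) :=
  ((enum_val i).1 * (enum_val j).1 + (enum_val i).2 * (enum_val j).2)%N.
have /(row_free_exp_transfer (zeta_prim R N0) z_prim) freeA :
    row_free (\matrix_(i, j) z ^+ E i j).
  apply: inj_row_free => v vA; pose f x := \sum_i v 0 i * (enum_val i == x)%:R.
  have fE i : f (enum_val i) = v 0 i.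
    rewrite /f (bigD1 i) //= eqxx mulr1 big1 ?addr0 // => j nj.
    by rewrite (inj_eq enum_val_inj) (negPf nj) mulr0.
  have f0 x : x \notin XA -> f x = 0.
    move=> nx; apply: big1 => i _; case: eqP => [ex|_]; last by rewrite mulr0.
    by rewrite -ex enum_valP in nx.
  have [[i vi]|v0] := pselect (exists i, v 0 i != 0); last first.
    apply/rowP => i; rewrite mxE; apply/eqP/negPn/negP => vi.
    by apply: v0; exists i.
  case: (noext f); split=> //; first by exists (enum_val i); rewrite fE.
  move=> xi nxi; have xiY : xi \in ~: YB by rewrite inE.
  rewrite (bigID (mem XA)) /= [X in _ + X]big1 ?addr0; last first.
    by move=> x /f0->; rewrite mul0r.
  rewrite big_enum_val /=; have /rowP/(_ (enum_rank_in xiY xi)) := vA.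
  rewrite !mxE => vA0; rewrite -[RHS]vA0; apply: eq_bigr => i' _; rewrite fE mxE /E.
  by rewrite enum_rankK_in.
set W := \matrix_(i, j) _ in freeA; pose V := pinvmx W.
have WV : W *m V = 1%:M by apply: mulmxVp.
pose b := \sum_j \sum_i nsq (V j i).
have b0 : 0 <= b.
  by rewrite /b; apply: sumr_ge0 => j _; apply: sumr_ge0 => i _; exact: nsq_ge0.
have bV j i : nsq (V j i) <= b.
  rewrite /b (bigD1 j) //= (bigD1 i) //= -addrA ler_wpDr //.
  by rewrite addr_ge0 ?sumr_ge0 // => ? _; rewrite ?sumr_ge0 // => *; apply: nsq_ge0.
pose K := m%:R * (2 ^+ n * b * nsq (N%:R : C)) + 1.
have c0 : 0 <= 2 ^+ n * b * nsq (N%:R : C).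
  apply: mulr_ge0; last exact: nsq_ge0.
  by apply: mulr_ge0 => //; apply: exprn_ge0.
have K1 : 1 <= K by rewrite lerDr; apply: mulr_ge0.
have K0 : 0 < K by apply: lt_le_trans K1.
exists (1 - K^-1).
  by rewrite subr_ge0 invf_le1 // K1 /= ltrBlDr ltrDl invr_gt0.
move=> f fX; have planch := plancherel f N0.
set S := \sum_x nsq (f x) in planch *.
have sumY : \sum_xi nsq (dft f xi) = \sum_(xi in YB) nsq (dft f xi) +
    \sum_(xi in ~: YB) nsq (dft f xi).
  rewrite (bigID (mem YB)) /=; congr (_ + _); apply: eq_bigl => xi.
  by rewrite finset.in_setC.
set SC := \sum_(xi in ~: YB) _ in sumY.
suff : S <= K * SC.
  rewrite -ler_pdivrMl // mulrC => SK; rewrite mulrBl mul1r [K^-1 * S]mulrC.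
  by rewrite lerBrDr [V in _ <= V](etrans (esym planch) sumY) lerD2l.
pose u := \row_i f (enum_val i) : 'rV[C]_m.
have uW j : (u *m W) 0 j = N%:R * dft f (enum_val j).
  rewrite dftE mulVKf ?pnatr_eq0 -?lt0n // mxE.
  rewrite (bigID (mem XA)) /= [X in _ = _ + X]big1 ?addr0; last first.
    by move=> x /fX->; rewrite mul0r.
  by rewrite [RHS]big_enum_val; apply: eq_bigr => i _; rewrite !mxE.
have SE : S = \sum_i nsq (u 0 i).
  rewrite /S (bigID (mem XA)) /= [X in _ + X]big1 ?addr0; last first.
    by move=> x /fX->; rewrite nsq0.
  by rewrite big_enum_val; apply: eq_bigr => i _; rewrite mxE.
have SC0 : 0 <= SC by apply: sumr_ge0 => *; apply: nsq_ge0.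
have ui i : nsq (u 0 i) <= 2 ^+ n * b * nsq (N%:R : C) * SC.
  have -> : u 0 i = \sum_j (u *m W) 0 j * V j i.
    by rewrite -[u in LHS]mulmx1 -WV mulmxA mxE.
  apply: le_trans (nsq_sum_le _ _) _; rewrite -mulrA -mulrA.
  rewrite -[index_enum _]enumT size_enum_ord ler_pM2l ?exprn_gt0 //.
  rewrite /SC big_enum_val /= !mulr_sumr enumT; apply: ler_sum => j _.
  by rewrite uW !nsqM [V in V <= _]mulrC ler_wpM2r // mulr_ge0 ?nsq_ge0.
rewrite SE; apply: (@le_trans _ _ (\sum_(i < m) 2 ^+ n * b * nsq (N%:R : C) * SC)).
  exact: ler_sum.
rewrite sumr_const card_ord -[V in V <= _]mulr_natl [V in V <= _]mulrA ler_wpM2r //.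
by rewrite /K lerDl.
Qed.

End SpectralGap.

(** Write k = n k0 + r; the norm at k is at most q^n, where q < 1 bounds the norm
    at k0, and n is at least k / k0 - 1. The constant C = 1/q pays for the
    incomplete last block. *)
Lemma exponential_decay (R : realType) (M : nat) (M_gt0 : (0 < M)%N) (A B : {set grid M})
    (k0 : nat) (rho : R) : (0 < k0)%N -> 0 <= rho < 1 -> energy_bound A B k0 rho ->
  exists beta C : R, [/\ 0 < beta, 0 < C &
     forall k : nat, (1 <= k)%N ->
       opnorm (indic_mul (cantor_iterate B k) \o @dft R (M ^ k)
                 \o indic_mul (cantor_iterate A k))
         <= C * M%:R `^ (- (k%:R * beta))].
Proof.
move=> k0_gt0 /andP[rho0 rho1] Ek0.
(* for M = 1 there is only one scale and the trivial bound suffices *)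
have [M1|M_gt1] := leqP M 1.
  have -> : M%:R = 1 :> R by case: M M_gt0 M1 {A B Ek0} => [|[]].
  exists 1, 1; split=> // k _; rewrite powR1 mulr1; apply: opnorm_le => //.
  by rewrite expr1n; apply: energy_bound1.
(* the maximum with 1/4 keeps q positive, so that it has a logarithm *)
pose q := Num.sqrt (Num.max rho 4^-1).
have r01 : 0 < Num.max rho 4^-1 < 1.
  by rewrite lt_max invr_gt0 ltr0n orbT gt_max rho1 invf_lt1 // ltr1n.
have /andP[r0 r1] := r01.
have q0 : 0 < q by rewrite sqrtr_gt0.
have q1 : q < 1 by rewrite -sqrtr1 ltr_sqrt.
have Eq : energy_bound A B k0 (q ^+ 2).
  move=> f fX; apply: le_trans (Ek0 f fX) _; rewrite ler_wpM2r //.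
    by apply: sumr_ge0 => *; apply: nsq_ge0.
  by rewrite /q sqr_sqrtr; [rewrite le_max lexx | exact: ltW].
have lnM : 0 < ln (M%:R : R) by rewrite ln_gt0 // ltr1n.
have lnq : ln q < 0 by rewrite ln_lt0 // q0.
have k00 : 0 < k0%:R :> R by rewrite ltr0n.
exists (- ln q / (k0%:R * ln M%:R)), q^-1; split.
- by rewrite divr_gt0 ?oppr_gt0 // mulr_gt0.
- by rewrite invr_gt0.
move=> k _; rewrite (divn_eq k k0).
set n := (k %/ k0)%N; set r := (k %% k0)%N.
have r_lt : (r < k0)%N by rewrite ltn_mod.
apply: le_trans (_ : q ^+ n <= _).
  apply: opnorm_le; first by rewrite exprn_ge0 // ltW.
  rewrite exprAC; apply: energy_bound_iter => //.
  by rewrite sqr_ge0.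
rewrite ler_pdivlMl // -exprS /powR pnatr_eq0 gtn_eqF //.
rewrite -[V in V ^+ _](lnK (_ : q \is Num.pos)) ?posrE // -expRM_natl ler_expR.
rewrite (_ : - _ * _ = (n * k0 + r)%:R / k0%:R * ln q); last first.
  by field; rewrite !gt_eqF.
apply: ler_wnM2r; first exact: ltW.
by rewrite ler_pdivrMr // -natrM ler_nat mulSn addnC leq_add2r ltnW.
Qed.

(** * Limits of discrete lines *)

Local Open Scope classical_set_scope.
Local Open Scope ring_scope.

Section Torus.
Variable R : realType.

Lemma torus_pi_eq (p q : R * R) : p.1 - q.1 \is a Num.int -> p.2 - q.2 \is a Num.int ->
  torus_pi p = torus_pi q.
Proof. by move=> h1 h2; apply/eqquotP; apply/andP. Qed.

Lemma torus_repr_pi (p : R * R) :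
  ((torus_repr (torus_pi p)).1 - p.1 \is a Num.int) /\
  ((torus_repr (torus_pi p)).2 - p.2 \is a Num.int).
Proof.
have /eqquotP/andP[h1 h2] : (\pi_{eq_quot (torus_equiv R)} (torus_repr (torus_pi p)) =
  \pi_{eq_quot (torus_equiv R)} p)%qT by rewrite reprK.
by [].
Qed.

(** The projection to the torus is continuous, so nearness may be tested in the
    plane, with any representative. *)
Lemma closure_torus (S : set (torus R)) (p : R * R) :
  (forall e, 0 < e -> exists q : R * R,
     [/\ `|q.1 - p.1| < e, `|q.2 - p.2| < e & S (torus_pi q)]) ->
  closure S (torus_pi p).
Proof.
move=> near_p U; have := @pi_continuous _ {eq_quot torus_equiv R}%qT p U.
move=> cont nU; have /nbhs_ballP[e /= e0 sub] := cont nU.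
have [q [q1 q2 Sq]] := near_p e e0.
exists (torus_pi q); split=> //; apply: sub.
by split; rewrite /ball /= distrC.
Qed.

End Torus.

Section LimitLine.
Variables (R : realType) (M : nat) (M_gt0 : (0 < M)%N) (M_gt1 : (1 < M)%N).
Variables (A : {set grid M}) (a b s t : int).
Hypothesis bezout : s * a + t * b = 1.

(** Arbitrarily fine scales carry a discrete line in the D-neighbourhood of the
    Cantor iterate, with D negligible compared to M^k. *)
Definition thick_lines := forall E K : nat, exists k D : nat, exists c : int,
  [/\ (K <= k)%N, (E * D <= M ^ k)%N & forall xi : int * int,
    ((M ^ k)%:Z %| xi.1 * a + xi.2 * b - c)%Z -> digits_within M_gt0 A k D xi].

Lemma cluster_point (theta : nat -> R) : (forall n, 0 <= theta n <= 1) ->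
  exists th : R, forall e n0, 0 < e -> exists2 n, (n0 <= n)%N & `|theta n - th| < e.
Proof.
move=> th01; have cpt := @segment_compact R 0 1.
have [|th [_ clth]] := cpt (theta @ \oo) _.
  by exists 0%N => // n _; rewrite /= in_itv /= th01.
exists th => e n0 e0.
have [||y [/= [n n0n <-] By]] := clth [set theta n | n in [set n | (n0 <= n)%N]] (ball th e).
- by exists n0 => // n /= n0n; exists n.
- exact: nbhsx_ballx.
by exists n => //; rewrite distrC.
Qed.

(** The digits of the integer part of M^i h / M^k are the i leading digits
    of h. *)
Lemma scaled_point_in_base k i (h1 h2 : nat) : (i <= k)%N ->
  (h1 < M ^ k)%N -> (h2 < M ^ k)%N -> digits_in M_gt0 A k h1 h2 ->
  [set p : R * R | [/\ 0 <= p.1 < 1, 0 <= p.2 < 1 &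
      exists2 d : grid (M ^ i), d \in cantor_iterate A i &
        Num.floor ((M ^ i)%:R * p.1) = d.1%:Z /\
        Num.floor ((M ^ i)%:R * p.2) = d.2%:Z]]
    (h1%:R / (M ^ k)%:R, h2%:R / (M ^ k)%:R).
Proof.
move=> ik h1k h2k hA; have N0 j : 0 < (M ^ j)%:R :> R by rewrite ltr0n expn_gt0 M_gt0.
have in01 h : (h < M ^ k)%N -> 0 <= h%:R / (M ^ k)%:R < (1 : R).
  by move=> hk; rewrite divr_ge0 ?ler0n //= ltr_pdivrMr // mul1r ltr_nat.
have ek : (M ^ k = M ^ i * M ^ (k - i))%N by rewrite -expnD subnKC.
have lt_top h : (h < M ^ k)%N -> (h %/ M ^ (k - i) < M ^ i)%N.
  by rewrite ltn_divLR ?expn_gt0 ?M_gt0 // -ek.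
have floorE h : Num.floor ((M ^ i)%:R * (h%:R / (M ^ k)%:R) : R) = (h %/ M ^ (k - i))%N%:Z.
  apply: floor_def; rewrite mulrA ler_pdivlMr // ltr_pdivrMr // -!pmulrn.
  rewrite -!natrM ler_nat ltr_nat ek ![(_ * (M ^ i * _))%N]mulnCA.
  rewrite leq_mul2l ltn_mul2l expn_gt0 M_gt0 leq_trunc_div orbT /=.
  by rewrite -ltn_divLR ?expn_gt0 ?M_gt0 // addn1.
split=> /=; [exact: in01|exact: in01|].
exists (Ordinal (lt_top _ h1k), Ordinal (lt_top _ h2k)); last by rewrite !floorE.
rewrite (in_cantor_iterate M_gt0) /=.
move: hA; rewrite {1}(divn_eq h1 (M ^ (k - i))) {1}(divn_eq h2 (M ^ (k - i))).
have -> : digits_in M_gt0 A k = digits_in M_gt0 A ((k - i) + i) by rewrite subnK.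
by rewrite digits_in_cat ?ltn_mod ?expn_gt0 ?M_gt0 // => /andP[].
Qed.

(** A discrete line at scale k, divided by M^k, is the set of grid points of a
    real line a X + b Y = c / M^k modulo 1. Its offset is determined modulo 1,
    so the offsets have a cluster point th, and the line a X + b Y = th is
    approximated by lines of the sequence with errors 1 / M^k from the grid and
    D / M^k from the neighbourhood. The point th (s, t) is on it because
    s a + t b = 1. *)
Lemma limit_line : thick_lines ->
  exists p : torus R, torus_line (b%:~R, - a%:~R) p `<=` limit_cantor_set A.
Proof.
move=> thick.
pose P n (g : nat * nat * int) := [/\ (n.+1 <= g.1.1)%N, (n.+1 * g.1.2 <= M ^ g.1.1)%N &
    forall xi : int * int,
    ((M ^ g.1.1)%:Z %| xi.1 * a + xi.2 * b - g.2)%Z ->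
    digits_within M_gt0 A g.1.1 g.1.2 xi].
have [f fP] : {f & forall n, P n (f n)}.
  by apply: boolp.choice => n; have [k [D [c kDc]]] := thick n.+1 n.+1; exists (k, D, c).
have N0 k : 0 < (M ^ k)%:R :> R by rewrite ltr0n expn_gt0 M_gt0.
have Nz k : (M ^ k)%:Z != 0 by rewrite eqz_nat -lt0n expn_gt0 M_gt0.
pose theta n : R := (`|(((f n).2)%R %% (M ^ (f n).1.1)%N)%Z|%N)%:R / (M ^ (f n).1.1)%:R.
have [|th thP] := @cluster_point theta.
  move=> n; rewrite /theta divr_ge0 ?ler0n //= ler_pdivrMr // mul1r ler_nat.
  by rewrite ltnW // -ltz_nat gez0_abs ?modz_ge0 // ltz_pmod // ltz_nat expn_gt0 M_gt0.
pose p0 : R * R := (th * s%:~R, th * t%:~R).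
exists (torus_pi p0) => _ [tau _ <-] i /= i_ge1.
have [r1 r2] := torus_repr_pi p0.
rewrite (@torus_pi_eq R _ (tau * b%:~R + p0.1, tau * - a%:~R + p0.2)); last 2 first.
- by rewrite /= opprD addrACA subrr add0r.
- by rewrite /= opprD addrACA subrr add0r.
apply: closure_torus => e e0.
pose K : R := `|s%:~R| + `|t%:~R| + `|a%:~R| + `|b%:~R| + 1.
have K0 : 0 < K by rewrite ltr_wpDl // !addr_ge0.
pose eta := e / (2 * K).
have eta0 : 0 < eta by rewrite divr_gt0 // mulr_gt0.
have [n0 n0P] : exists n0 : nat, (n0.+1)%:R^-1 < eta.
  by exists (Num.truncn eta^-1); rewrite invf_plt ?posrE ?ltr0n // truncnS_gt.
have [n n_ge thn] := thP eta (maxn n0 i) eta0.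
have nP : n.+1%:R^-1 < eta.
  apply: le_lt_trans n0P; rewrite lef_pV2 ?posrE ?ltr0n // ler_nat ltnS.
  by apply: leq_trans n_ge; apply: leq_maxl.
have := fP n; case En: (f n) => [[k D] c] [/= kn Dk kP].
move: thn; rewrite /theta En /=; set cm := (c %% _)%Z => thn.
have cm0 : 0 <= cm by apply: modz_ge0.
rewrite [(`|cm|%N)%:R]pmulrn gez0_abs // in thn.
have cmc : ((M ^ k)%:Z %| cm - c)%Z by rewrite -eqz_mod_dvd modz_mod.
clearbody cm.
pose T := Num.floor (tau * (M ^ k)%:R).
(* the point of the discrete line with parameter T, close to tau M^k *)
pose xi : int * int := (cm * s + T * b, cm * t - T * a).
have [|u [v [uD vD uv]]] := kP xi.
  have -> : xi.1 * a + xi.2 * b - c = cm * (s * a + t * b) - c by rewrite /xi /=; ring.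
  by rewrite bezout mulr1.
have gen (p q x y w r r' n' : R) : n' != 0 ->
    (p * x + q * y + w) / n' - (r * y + r' * x) =
    (p / n' - r') * x - (r * n' - q) * (y / n') + w / n' by move=> h; field.
have err (w : int) (x y : int) : (`|x%:~R| <= K - 1 - `|y%:~R| :> R) -> (0 <= w <= D%:Z) ->
    `|(cm * x + T * y + w)%:~R / (M ^ k)%:R - (tau * y%:~R + th * x%:~R)| < e.
  move=> xy /andP[w0 wD].
  have -> : (cm * x + T * y + w)%:~R / (M ^ k)%:R - (tau * y%:~R + th * x%:~R) =
    (cm%:~R / (M ^ k)%:R - th) * x%:~R - (tau * (M ^ k)%:R - T%:~R) * (y%:~R / (M ^ k)%:R)
      + w%:~R / (M ^ k)%:R.
    by rewrite !intrD !intrM; apply: gen; rewrite gt_eqF.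
  have Ninv : (M ^ k)%:R^-1 <= eta.
    apply: ltW; apply: le_lt_trans nP.
    rewrite lef_pV2 ?posrE ?ltr0n ?expn_gt0 ?M_gt0 //.
    by rewrite ler_nat ltnW // (leq_ltn_trans kn) // ltn_expl.
  have Ninv0 : 0 <= (M ^ k)%:R^-1 :> R by rewrite invr_ge0 ltW.
  have e1 : `|(cm%:~R / (M ^ k)%:R - th) * x%:~R| <= eta * `|x%:~R|.
    by rewrite normrM ler_wpM2r // ltW.
  have e2 : `|(tau * (M ^ k)%:R - T%:~R) * (y%:~R / (M ^ k)%:R)| <= eta * `|y%:~R|.
    rewrite normrM normrM (ger0_norm Ninv0) -[X in _ <= X]mul1r.
    apply: ler_pM => //.
      have /andP[f1 f2] := floor_itv (tau * (M ^ k)%:R).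
      rewrite ger0_norm ?subr_ge0 // lerBlDl ltW //.
      by rewrite -/T intrD in f2.
    by rewrite mulrC ler_wpM2r.
  have e3 : `|w%:~R / (M ^ k)%:R| <= eta.
    rewrite ger0_norm ?mulr_ge0 ?ler0z //; apply: ltW; apply: le_lt_trans nP.
    rewrite ler_pdivrMr // mulrC ler_pdivlMr ?ltr0n //.
    apply: (@le_trans _ _ (D%:R * n.+1%:R)).
      by rewrite ler_wpM2r // pmulrn ler_int.
    by rewrite -natrM ler_nat mulnC.
  apply: le_lt_trans (ler_normD _ _) _.
  apply: le_lt_trans (lerD (ler_normB _ _) (lexx _)) _.
  apply: le_lt_trans (lerD (lerD e1 e2) e3) _.
  rewrite -mulrDr -[X in _ + X]mulr1 -mulrDr.
  apply: (@le_lt_trans _ _ (eta * K)).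
    apply: ler_wpM2l; [exact: ltW | lra].
  rewrite /eta invfM mulrA mulfVK ?gt_eqF // ltr_pdivrMr // ltr_pMr //.
  by rewrite ltr1n.
exists ((xi.1 + u%:Z)%:~R / (M ^ k)%:R, (xi.2 + v%:Z)%:~R / (M ^ k)%:R); split.
- rewrite /= /xi /=; apply: err; last by rewrite lez_nat uD.
  by rewrite /K; have := normr_ge0 (t%:~R : R); have := normr_ge0 (a%:~R : R); lra.
- rewrite /= /xi /= -mulrN -mulrNz; apply: err; last by rewrite lez_nat vD.
  rewrite mulrNz normrN.
  by rewrite /K; have := normr_ge0 (s%:~R : R); have := normr_ge0 (b%:~R : R); lra.
pose h1 := `|((xi.1 + u%:Z)%R %% (M ^ k)%N)%Z|%N.
pose h2 := `|((xi.2 + v%:Z)%R %% (M ^ k)%N)%Z|%N.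
have lt_h (x : int) : (`|(x %% (M ^ k)%N)%Z| < M ^ k)%N.
  by rewrite -ltz_nat gez0_abs ?modz_ge0 // ltz_pmod // ltz_nat expn_gt0 M_gt0.
have divE (x : int) :
    (x%:~R / (M ^ k)%:R - (`|(x %% (M ^ k)%N)%Z|%N)%:R / (M ^ k)%:R : R) \is a Num.int.
  rewrite -mulrBl pmulrn gez0_abs ?modz_ge0 // -intrB.
  rewrite {1}(divz_eq x (M ^ k)%N) addrK intrM mulfK ?intr_int //.
  by rewrite -pmulrn gt_eqF.
exists (h1%:R / (M ^ k)%:R, h2%:R / (M ^ k)%:R); last first.
  by apply: torus_pi_eq; rewrite -opprB rpredN; apply: divE.
apply: scaled_point_in_base => //; try exact: lt_h.
by rewrite (leq_trans _ kn) // ltnW // ltnS (leq_trans _ n_ge) // leq_maxr.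
Qed.

End LimitLine.

Local Close Scope classical_set_scope.

(** * Points of Cantor iterates on a line *)

Section Counting.
Variables (M : nat) (M_gt0 : (0 < M)%N) (A : {set grid M}) (a b s t : int).
Hypothesis bezout : s * a + t * b = 1.

Definition cantor_line k c :=
  [set x : grid (M ^ k) | (x \in cantor_iterate A k) && on_line (a, b) c x].

Lemma in_cantor_line k c x :
  (x \in cantor_line k c) = (x \in cantor_iterate A k) && on_line (a, b) c x.
Proof. exact: finset.in_set. Qed.

Let gt0 k : (0 < M ^ k)%N. Proof. by rewrite expn_gt0 M_gt0. Qed.

(** When the low digits y of a point on the line are fixed, its high digits lie
    on a line at level j, which misses at least one of its at most M^j
    points; and y itself lies on the line at level k. *)
Lemma card_cantor_line_step j k n :
  (forall c, exists2 h : grid (M ^ j), on_line (a, b) c h & h \notin cantor_iterate A j) ->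
  (forall c, (#|cantor_line k c| <= n)%N) ->
  forall c, (#|cantor_line (k + j) c| <= n * (M ^ j).-1)%N.
Proof.
move=> gap cnt c; have j0 := gt0 j.
have defN : (M ^ (k + j) = M ^ j * M ^ k)%N by rewrite expnD mulnC.
pose g (y : grid (M ^ k)) := ((c - dot y (a, b)) %/ (M ^ k)%N)%Z.
rewrite cardsE -sum1_card big_mkcond (sum_grid_join (gt0 (k + j)) defN) exchange_big /=.
apply: (@leq_trans (\sum_(y in cantor_line k c) (M ^ j).-1)).
  rewrite [X in (_ <= X)%N]big_mkcond /=; apply: leq_sum => y _.
  have dotE (x : grid (M ^ j)) : dot (join (gt0 (k + j)) x y) (a, b) - c =
      dot x (a, b) * (M ^ k)%:Z - (c - dot y (a, b)).
    by rewrite /dot (join1 _ defN) (join2 _ defN) !PoszD !PoszM; ring.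
  have splitE x : join (gt0 (k + j)) x y \in
        [pred z | (z \in cantor_iterate A (k + j)) && on_line (a, b) c z] ->
      (y \in cantor_line k c) && (x \in cantor_line j (g y)).
    rewrite inE /= (join_in_cantor_iterate M_gt0 _ _ defN) => /andP[/andP[yX xX]].
    rewrite /on_line dotE defN PoszM => /dvdzP[q eq_q].
    have eq_c : c - dot y (a, b) = (dot x (a, b) - q * (M ^ j)%:Z) * (M ^ k)%:Z.
      by rewrite mulrBl -mulrA -eq_q; ring.
    rewrite !in_cantor_line yX xX /on_line /g eq_c mulzK; last first.
      by rewrite eqz_nat -lt0n gt0.
    apply/andP; split; apply/dvdzP; last by exists q; ring.
    by exists (- (dot x (a, b) - q * (M ^ j)%:Z)); rewrite mulNr -eq_c; ring.
  case: ifP => yl; last first.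
    rewrite leqn0 sum_nat_eq0; apply/forallP => x; apply/implyP => _.
    by case: ifP => // /splitE; rewrite yl.
  apply: leq_trans (_ : #|cantor_line j (g y)| <= _)%N.
    rewrite -sum1_card [X in (_ <= X)%N]big_mkcond; apply: leq_sum => x _.
    by case: ifP => // /splitE/andP[_ ->].
  have [h hl hX] := gap (g y); rewrite -ltnS prednK //.
  apply: leq_trans (card_line bezout (g y) j0); apply: proper_card.
  apply/properP; split.
    by apply/fintype.subsetP => x; rewrite in_cantor_line finset.in_set => /andP[].
  by exists h; [rewrite finset.in_set | rewrite in_cantor_line (negPf hX)].
by rewrite sum_nat_const leq_mul2r cnt orbT.
Qed.

Lemma card_cantor_line j :
  (forall c, exists2 h : grid (M ^ j), on_line (a, b) c h & h \notin cantor_iterate A j) ->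
  forall m r c, (#|cantor_line (r + m * j) c| <= M ^ r * (M ^ j).-1 ^ m)%N.
Proof.
move=> gap m r; elim: m => [|m IHm] c.
  rewrite mul0n addn0 muln1; apply: leq_trans (card_line bezout c (gt0 r)).
  apply: subset_leq_card; apply/fintype.subsetP => x.
  by rewrite in_cantor_line finset.in_set => /andP[].
rewrite mulSnr addnA expnSr mulnA.
exact: card_cantor_line_step.
Qed.

End Counting.

(** * Choice of the degree *)

Section Growth.

(** Bernoulli's inequality (1 + 1/q)^m >= 1 + m/q with cleared denominators. *)
Lemma bernoulli_growth q m : (q ^ m * (q + m) <= q * (q.+1) ^ m)%N.
Proof.
elim: m => [|m IHm]; first by rewrite !expn0 addn0 mul1n muln1.
rewrite !expnS [X in (_ <= X)%N]mulnCA.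
apply: leq_trans (_ : q.+1 * (q ^ m * (q + m)) <= _)%N; last by rewrite leq_mul2l IHm orbT.
rewrite -mulnA [X in (_ <= X)%N]mulnCA mulnCA leq_mul2l; apply/orP; right.
by rewrite mulSn mulnDr; lia.
Qed.

Lemma exponential_beats_linear q C : (0 < q)%N ->
  exists m0, forall m, (m0 <= m)%N -> (C * q ^ m < (q.+1) ^ m)%N.
Proof.
move=> q0; exists (C * q)%N => m le_m.
rewrite -(ltn_pmul2l q0); apply: leq_trans (bernoulli_growth q m).
have : (0 < q ^ m)%N by rewrite expn_gt0 q0.
move: (q ^ m)%N => Q Q0; nia.
Qed.

(** The cube of Bernoulli's inequality with m = k / 3 gives a cubic factor. *)
Lemma exponential_beats_quadratic q C : (0 < q)%N ->
  exists k0, forall k, (k0 <= k)%N -> (C * k ^ 2 * q ^ k <= (q.+1) ^ k)%N.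
Proof.
move=> q0; exists (3 * (25 * C * q ^ 3 + 1))%N => k le_k.
pose m := (k %/ 3)%N.
have km : (k = 3 * m + k %% 3)%N by rewrite mulnC -divn_eq.
have r3 : (k %% 3 < 3)%N by rewrite ltn_mod.
have le_m : (25 * C * q ^ 3 + 1 <= m)%N by rewrite leq_divRL //; lia.
have q3 : (0 < q ^ 3)%N by rewrite expn_gt0 q0.
rewrite -(leq_pmul2l q3).
have h : (q ^ (3 * m) * m ^ 3 <= q ^ 3 * (q.+1) ^ (3 * m))%N.
  rewrite ![(3 * m)%N]mulnC !expnM -!expnMn leq_exp2r //.
  apply: leq_trans (bernoulli_growth q m); rewrite leq_mul2l leq_addl orbT //.
apply: (@leq_trans (q ^ (3 * m) * m ^ 3 * q ^ (k %% 3))).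
  rewrite {2}km expnD; set Q := (q ^ (3 * m))%N; set r := (q ^ (k %% 3))%N.
  have -> : (q ^ 3 * (C * k ^ 2 * (Q * r)) = Q * r * (q ^ 3 * C * k ^ 2))%N by ring.
  have -> : (Q * m ^ 3 * r = Q * r * m ^ 3)%N by ring.
  rewrite leq_mul2l; apply/orP; right.
  have k5 : (k <= 5 * m)%N by lia.
  apply: (@leq_trans (q ^ 3 * C * (5 * m) ^ 2)).
    by rewrite leq_mul2l leq_exp2r // k5 orbT.
  rewrite expnMn [X in (_ <= X)%N]expnS.
  have -> : (q ^ 3 * C * (5 ^ 2 * m ^ 2) = (25 * C * q ^ 3) * m ^ 2)%N by ring.
  by rewrite leq_mul2r (leq_trans _ le_m) ?leq_addr ?orbT.
rewrite [X in ((q.+1) ^ X)%N]km expnD mulnA; apply: leq_mul => //.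
by case: (k %% 3)%N => // r; rewrite leq_exp2r.
Qed.

End Growth.

(** As n < M^2, the quotient of M^(2 k) by n^k grows exponentially, so that
    d = M^k / W satisfies n^k < (d + 1)^2 even with W linear in k. The factor
    w = k M^2 + M + 3 is such that D + 2 d = d w, and W = 8 M E w makes D at most
    M^k / E and d w at most M^(k-1) / 8. *)
Lemma degree_parameter (M n E : nat) : (1 < M)%N -> (n < M ^ 2)%N -> (0 < E)%N ->
  exists K, forall k, (K <= k)%N -> exists d,
    let D := (d + k * (M * M * d) + M * d)%N in
    let L := (M ^ k.-1 - 1 - (D + (d + d)))%N in
    [/\ (0 < k)%N, (n ^ k < d.+1 * d.+1)%N, (E * D <= M ^ k)%N,
        (D + (d + d) + L = M ^ k.-1 - 1)%N &
        (2 * d <= L)%N /\ (M ^ k.-1 <= 2 * (L - 2 * d))%N].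
Proof.
move=> M_gt1 n_lt E_gt0; pose C := ((8 * M * E) * (M * M + M + 3))%N.
have q_gt0 : (0 < (M ^ 2).-1)%N.
  by rewrite -ltnS prednK ?expn_gt0 ?(ltnW M_gt1) // -(expn0 M) ltn_exp2l.
have [k0 k0P] := exponential_beats_quadratic (C ^ 2) q_gt0.
exists (maxn k0 4) => k; rewrite geq_max => /andP[k0k k4].
have k_gt0 : (0 < k)%N by lia.
pose w := (k * (M * M) + M + 3)%N; pose W := (8 * M * E * w)%N.
have W_gt0 : (0 < W)%N by rewrite /W /w !muln_gt0 E_gt0; lia.
exists (M ^ k %/ W)%N; set d := (M ^ k %/ W)%N => D L.
have Dw : (D + (d + d) = d * w)%N by rewrite /D /w; ring.
have dW : (d * W <= M ^ k)%N by apply: leq_trunc_div.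
have ek : (M ^ k = M * M ^ k.-1)%N by rewrite -expnS prednK.
have P8 : (8 <= M ^ k.-1)%N.
  apply: (@leq_trans (M ^ 3)); last by rewrite leq_exp2l //; lia.
  by rewrite -[8%N]/(2 ^ 3)%N leq_exp2r.
have dw8 : (8 * (d * w) <= M ^ k.-1)%N.
  rewrite -(leq_pmul2l (ltnW M_gt1)) -ek; apply: leq_trans dW.
  have -> : (M * (8 * (d * w)) = 8 * M * (d * w) * 1)%N by ring.
  have -> : (d * W = 8 * M * (d * w) * E)%N by rewrite /W; ring.
  by rewrite leq_mul2l E_gt0 orbT.
have d3 : (3 * d <= d * w)%N by rewrite mulnC leq_mul2l /w; lia.
have ED : (E * D <= M ^ k)%N.
  apply: leq_trans dW; apply: leq_trans (_ : E * (d * w) <= _)%N.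
    by rewrite leq_mul2l -Dw leq_addr orbT.
  have -> : (d * W = E * (d * w) * (8 * M))%N by rewrite /W; ring.
  by rewrite leq_pmulr //; lia.
have Ld : L = (M ^ k.-1 - 1 - d * w)%N by rewrite /L Dw.
split=> //; last 2 first.
- by rewrite Dw Ld; lia.
- by rewrite Ld; lia.
rewrite ltnNge; apply/negP => le_d.
have Wd : (M ^ k < d.+1 * W)%N by rewrite -ltn_divLR.
have qE : ((M ^ 2).-1.+1 = M ^ 2)%N by rewrite prednK // expn_gt0 (ltnW M_gt1).
have := k0P k k0k; rewrite qE leqNgt => /negP; apply.
have n_le : (n ^ k <= (M ^ 2).-1 ^ k)%N by rewrite leq_exp2r // -ltnS qE.
have wk : (W <= C * k)%N.
  rewrite /W /C -[leqRHS]mulnA leq_mul2l; apply/orP; right; rewrite /w.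
  by rewrite !mulnDl [(k * _)%N]mulnC; nia.
rewrite -expnM mulnC expnM.
apply: leq_trans (_ : (d.+1 * W) ^ 2 <= _)%N; first by rewrite ltn_exp2r.
rewrite expnMn -[(C ^ 2 * _)%N]expnMn mulnC; apply: leq_mul; first by rewrite leq_exp2r.
by apply: leq_trans n_le; rewrite -mulnn.
Qed.

(** * Lines produced by an extremizer *)

Section Extremizer.
Variables (M : nat) (M_gt0 : (0 < M)%N) (A B : {set grid M}) (k : nat) (z : algC).
Hypotheses (k_gt0 : (0 < k)%N) (z_prim : (M ^ k).-primitive_root z).
Notation N := (M ^ k)%N.
Notation pt1 := (fun x : grid N => z ^+ x.1).
Notation pt2 := (fun x : grid N => z ^+ x.2).

Let N_gt0 : (0 < N)%N. Proof. by rewrite expn_gt0 M_gt0. Qed.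
Let N_neq0 : N%:Z != 0. Proof. by rewrite eqz_nat -lt0n. Qed.
Let z0 : z != 0. Proof. by rewrite (prim_root_eq0 z_prim) -lt0n. Qed.

Lemma lt_residue (x : int) : (`|(x %% N)%Z| < N)%N.
Proof. by rewrite -ltz_nat gez0_abs ?modz_ge0 // ltz_pmod // ltz_nat. Qed.

Definition residue_point (xi : int * int) : grid N :=
  (Ordinal (lt_residue xi.1), Ordinal (lt_residue xi.2)).

Lemma moment_residue (f : grid N -> algC) xi : moment z f xi =
  \sum_x f x * z ^+ (x.1 * (residue_point xi).1 + x.2 * (residue_point xi).2).
Proof.
apply: eq_bigr => x _; congr (_ * _).
rewrite exprnP; apply/eqP; rewrite (eq_prim_root_exprz _ _ z_prim).
rewrite /dot PoszD !PoszM /= !gez0_abs ?modz_ge0 //; apply/dvdzP.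
exists ((x.1 : nat)%:Z * (xi.1 %/ N)%Z + (x.2 : nat)%:Z * (xi.2 %/ N)%Z).
by rewrite {1}(divz_eq xi.1 N) {1}(divz_eq xi.2 N); ring.
Qed.

Lemma moment_digits_in (f : grid N -> algC) xi : extremizer A B z f ->
  moment z f xi != 0 ->
  digits_in M_gt0 B k `|(xi.1 %% N)%Z| `|(xi.2 %% N)%Z|.
Proof.
move=> [_ _ fY]; apply: contraNT => nY; rewrite moment_residue fY //.
by rewrite (in_cantor_iterate M_gt0).
Qed.

Lemma moment_nat_neq0 (f : grid N -> algC) (u v : nat) : extremizer A B z f ->
  (u < N)%N -> (v < N)%N -> moment z f (u%:Z, v%:Z) != 0 -> digits_in M_gt0 B k u v.
Proof.
by move=> ext uN vN /(moment_digits_in ext); rewrite !modz_nat !modn_small.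
Qed.

(** Frequencies whose leading digit is beta are outside Y_k, so the transform of
    f vanishes on a square of side M^(k-1); the modulation moves this square to
    the origin. *)
Lemma modulated_vanishing_moments (f : grid N -> algC) (beta : grid M) :
  extremizer A B z f -> beta \notin B ->
  let xi0 : int * int := ((beta.1 * M ^ k.-1)%N%:Z, (beta.2 * M ^ k.-1)%N%:Z) in
  vanishing_moments pt1 pt2 (fun x => f x * z ^ dot x xi0) (M ^ k.-1 - 1).
Proof.
move=> ext nB xi0 P dP; have P_gt0 : (0 < M ^ k.-1)%N by rewrite expn_gt0 M_gt0.
have ek : (M ^ k = M * M ^ k.-1)%N by rewrite -expnS prednK.
transitivity (moment z (twist pt1 pt2 (fun x => f x * z ^ dot x xi0) P) 0).
  by apply: eq_bigr => x _; rewrite /twist /dot /= !mulr0 addr0 expr0z mulr1.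
rewrite (moment_twist z_prim _ _ dP) big1 // => u _; rewrite big1 // => v _.
have lt_u (w : 'I_(M ^ k.-1 - 1).+1) : (w < M ^ k.-1)%N.
  by apply: leq_trans (ltn_ord w) _; rewrite subn1 prednK.
have lt_N (b : 'I_M) (w : 'I_(M ^ k.-1 - 1).+1) : (b * M ^ k.-1 + w < N)%N.
  rewrite ek; apply: leq_trans (_ : (b.+1 * M ^ k.-1 <= _)%N).
    by rewrite mulSn addnC ltn_add2r lt_u.
  by rewrite leq_mul2r ltn_ord orbT.
transitivity (P`_u`_v *
  moment z f ((beta.1 * M ^ k.-1 + u)%N%:Z, (beta.2 * M ^ k.-1 + v)%N%:Z)).
  congr (_ * _); apply: eq_bigr => x _; rewrite -mulrA -expfzDr //; congr (_ * z ^ _).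
  by rewrite /dot /= !PoszD; ring.
suff -> : moment z f ((beta.1 * M ^ k.-1 + u)%N%:Z, (beta.2 * M ^ k.-1 + v)%N%:Z) = 0.
  by rewrite mulr0.
apply/eqP/negPn/negP => /(moment_nat_neq0 ext (lt_N _ _) (lt_N _ _)).
have lt_k : (k.-1 < k)%N by rewrite prednK.
move=> /forallP/(_ (Ordinal lt_k)) /=; rewrite -[X in digit _ _ X]addn0 digit_high //.
have digit0 (b : 'I_M) : digit M_gt0 b 0 = b.
  by apply: val_inj; rewrite /= expn0 divn1 modn_small.
rewrite -[X in digit _ (_ + v)%N X]addn0 digit_high // !digit0 -surjective_pairing.
by rewrite (negPf nB).
Qed.

(** This is [line_structure] for the modulated extremizer. The remaining budget L is of
    order M^(k-1), so h (L - 2 h) < M^k bounds a and b independently of k. *)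
Lemma extremizer_line_structure (f : grid N -> algC) d : extremizer A B z f ->
  B \proper {: grid M} -> (#|A| ^ k < d.+1 * d.+1)%N ->
  let D := (d + k * (M * M * d) + M * d)%N in
  let L := (M ^ k.-1 - 1 - (D + (d + d)))%N in
  (D + (d + d) + L = M ^ k.-1 - 1)%N -> (2 * d <= L)%N ->
  (M ^ k.-1 <= 2 * (L - 2 * d))%N ->
  exists a b : int, [/\ coprimez a b, (`|a| < 2 * M)%N && (`|b| < 2 * M)%N,
    exists c, (M ^ k.-1 <= 2 * #|cantor_line A a b k c|)%N &
    exists c : int, forall xi : int * int, (N%:Z %| xi.1 * b - xi.2 * a - c)%Z ->
      digits_within M_gt0 B k D xi].
Proof.
move=> ext B_proper cA D L eD dL PL.
have [_ [beta _ nB]] := fintype.properP B_proper.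
pose xi0 : int * int := ((beta.1 * M ^ k.-1)%N%:Z, (beta.2 * M ^ k.-1)%N%:Z).
pose g x := f x * z ^ dot x xi0.
have mom : vanishing_moments pt1 pt2 g (D + (d + d) + L).
  by rewrite eD; apply: modulated_vanishing_moments.
have [[x0 fx0] fX _] := ext.
have g0 : nonzero g by exists x0; rewrite mulf_neq0 // expfz_neq0.
have gX x : g x != 0 -> x \in cantor_iterate A k.
  by apply: contraNT => /fX; rewrite /g => ->; rewrite mul0r.
have cX : (#|cantor_iterate A k| < d.+1 * d.+1)%N.
  exact: leq_ltn_trans (card_cantor_iterate M_gt0 A k) cA.
have [a [b [co hd hN [c cnt] [c' c'P]]]] :=
  line_structure M_gt0 k_gt0 z_prim g0 gX cX mom dL.
exists a, b; set h := maxn _ _ in hd hN cnt.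
have ek : (M ^ k = M * M ^ k.-1)%N by rewrite -expnS prednK.
have P_gt0 : (0 < M ^ k.-1)%N by rewrite expn_gt0 M_gt0.
have Lh : (M ^ k.-1 <= 2 * (L - 2 * h))%N.
  by apply: leq_trans PL _; rewrite leq_mul2l leq_sub2l // leq_mul2l.
have h2M : (h < 2 * M)%N.
  rewrite -(ltn_pmul2r P_gt0); apply: leq_ltn_trans (_ : h * (2 * (L - 2 * h)) < _)%N.
    by rewrite leq_mul2l Lh orbT.
  by rewrite mulnCA -mulnA ltn_pmul2l // -ek.
split=> //.
- by rewrite -gtn_max.
- exists c; apply: leq_trans Lh _; rewrite leq_mul2l /=; apply: leq_trans (ltnW cnt) _.
  exact: leqnn.
exists (c' + xi0.1 * b - xi0.2 * a) => xi xiP.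
have E p q : (xi.1 - p) * b - (xi.2 - q) * a - c' = xi.1 * b - xi.2 * a - (c' + p * b - q * a).
  by ring.
have [|u [v [uD vD ne]]] := c'P (xi.1 - xi0.1, xi.2 - xi0.2).
  by rewrite [X in (_ %| X)%Z](E xi0.1 xi0.2).
exists u, v; split=> //; apply: (@moment_digits_in f (xi.1 + u%:Z, xi.2 + v%:Z) ext).
apply: contraNneq ne => m0; rewrite -m0; apply/eqP; apply: eq_bigr => x _.
rewrite -mulrA -expfzDr //; congr (_ * z ^ _); rewrite /dot /=; ring.
Qed.

End Extremizer.

(** * The dichotomy *)

Local Open Scope classical_set_scope.
Local Open Scope ring_scope.

Lemma infinite_pigeonhole (T : finType) (P : nat -> T -> Prop) :
  (forall n, exists t, P n t) -> exists t, forall n0, exists2 n, (n0 <= n)%N & P n t.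
Proof.
move=> exP; apply: contrapT => /forallNP noT.
pose Q t m := forall n, (m <= n)%N -> ~ P n t.
have [g gP] : {g & forall t, Q t (g t)}.
  apply: boolp.choice => t; have /existsNP[n0 /forall2NP nP] := noT t.
  by exists n0 => n le_n; have [] := nP n.
have [t Pt] := exP (\max_t g t)%N.
by apply: (gP t) Pt; apply: (leq_bigmax t).
Qed.

Section FullLines.
Variables (M : nat) (M_gt0 : (0 < M)%N) (M_gt1 : (1 < M)%N) (A : {set grid M}).
Variables (a b s t : int).
Hypothesis bezout : s * a + t * b = 1.

(** A line contained in the iterate is thick with D = 0. *)
Lemma full_lines_thick :
  (forall j, (0 < j)%N -> exists c, forall h : grid (M ^ j),
     on_line (a, b) c h -> h \in cantor_iterate A j) ->
  thick_lines M_gt0 A a b.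
Proof.
move=> full E K; have [c cP] := full K.+1 (ltn0Sn K).
exists K.+1, 0%N, c; split; rewrite ?muln0 // => xi xi_c; exists 0%N, 0%N.
have N0 : (M ^ K.+1)%N%:Z != 0 by rewrite eqz_nat -lt0n expn_gt0 M_gt0.
split=> //; rewrite !addr0.
have := cP (residue_point M_gt0 K.+1 xi); rewrite (in_cantor_iterate M_gt0); apply.
rewrite /on_line /dot /= !gez0_abs ?modz_ge0 //.
have key (q1 q2 r1 r2 x1 x2 m : int) : x1 = q1 * m + r1 -> x2 = q2 * m + r2 ->
    r1 * a + r2 * b - c = (x1 * a + x2 * b - c) - (q1 * a + q2 * b) * m.
  by move=> -> ->; ring.
rewrite (key _ _ _ _ _ _ _ (divz_eq xi.1 _) (divz_eq xi.2 _)).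
by rewrite rpredB // dvdz_mull.
Qed.

(** If at level j every line missed a point, the number of points on a line at
    level k would be at most M^r (M^j - 1)^m with k = r + m j, which is
    exponentially smaller than M^k. *)
Lemma populous_lines_full :
  (forall n0, exists2 k, (n0 <= k)%N &
     exists c, (M ^ k.-1 <= 2 * #|cantor_line A a b k c|)%N) ->
  forall j, (0 < j)%N -> exists c, forall h : grid (M ^ j),
     on_line (a, b) c h -> h \in cantor_iterate A j.
Proof.
move=> pop j j_gt0; apply: contrapT => /forallNP nofull.
have gap c : exists2 h : grid (M ^ j), on_line (a, b) c h & h \notin cantor_iterate A j.
  have /existsNP[h /not_implyP[hl /negP hX]] := nofull c; by exists h.
have Mj : (1 < M ^ j)%N by rewrite -(expn0 M) ltn_exp2l.
have q_gt0 : (0 < (M ^ j).-1)%N by rewrite -ltnS prednK // ltnW.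
have [m0 m0P] := exponential_beats_linear (2 * M) q_gt0.
have [k le_k [c cnt]] := pop (j * m0.+1)%N.
have k_gt0 : (0 < k)%N by apply: leq_trans le_k; rewrite muln_gt0 j_gt0.
pose m := (k %/ j)%N; pose r := (k %% j)%N.
have ek : k = (r + m * j)%N by rewrite addnC -divn_eq.
have le_m : (m0 <= m)%N by rewrite leq_divRL //; lia.
have := card_cantor_line M_gt0 bezout gap m r c.
rewrite -ek leqNgt => /negP; apply.
have := m0P m le_m; rewrite prednK ?(ltnW Mj) // => lt_m.
have r_gt0 : (0 < M ^ r)%N by rewrite expn_gt0 M_gt0.
have M2 : (0 < 2 * M)%N by rewrite muln_gt0.
rewrite -(ltn_pmul2l M2); apply: (@leq_trans (M ^ k)).
  have -> : (M ^ k = M ^ r * (M ^ j) ^ m)%N by rewrite {1}ek expnD [(m * j)%N]mulnC expnM.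
  by rewrite mulnCA ltn_pmul2l.
have ekM : (M ^ k = M * M ^ k.-1)%N by rewrite -expnS prednK.
apply: (@leq_trans (M * M ^ k.-1)); first by rewrite -ekM.
by rewrite mulnAC [leqRHS]mulnC leq_mul2l cnt orbT.
Qed.

End FullLines.

Theorem theorem2 (R : realType) (M : nat) (M_gt0 : (0 < M)%N)
    (A B : {set grid M})
    (A_proper : A \proper {: grid M}) (B_proper : B \proper {: grid M}) :
  (exists (v : R * R) (p q : torus R),
     [/\ v <> (0, 0),
         torus_line v p `<=` limit_cantor_set A &
         torus_line (perp v) q `<=` limit_cantor_set B])
  \/
  (exists beta C : R, [/\ 0 < beta, 0 < C &
     forall k : nat, (1 <= k)%N ->
       opnorm (indic_mul (cantor_iterate B k) \o @dft R (M ^ k)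
                 \o indic_mul (cantor_iterate A k))
         <= C * M%:R `^ (- (k%:R * beta))]).
Proof.
have N_gt0 k : (0 < M ^ k)%N by rewrite expn_gt0 M_gt0.
have [[k0 [k0_gt0 [z z_prim noext]]]|all_ext] := EM (exists k0, (0 < k0)%N /\
    exists2 z : algC, (M ^ k0).-primitive_root z & forall f, ~ @extremizer M A B k0 z f).
  right; have [rho rho01 Erho] := spectral_gap R M_gt0 z_prim noext.
  exact: (exponential_decay M_gt0 k0_gt0 rho01 Erho).
left; have ext k (z : algC) : (0 < k)%N -> (M ^ k).-primitive_root z ->
    exists f, @extremizer M A B k z f.
  move=> k_gt0 z_prim; apply: contrapT => /forallNP nof.
  by apply: all_ext; exists k; split=> //; exists z.
have cA : (#|A| < M ^ 2)%N.
  by apply: leq_trans (proper_card A_proper) _; rewrite card_prod card_ord -mulnn.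
(* for M = 1 a proper alphabet is empty and supports no extremizer *)
have M_gt1 : (1 < M)%N.
  rewrite ltn_neqAle M_gt0 andbT; apply/negP => /eqP M1.
  have [z z_prim] := C_prim_root_exists (N_gt0 1%N).
  have [f [[x fx] fX _]] := ext 1%N z isT z_prim.
  have xX : x \in cantor_iterate A 1 by apply: contraNT fx => /fX ->.
  have A0 : #|A| = 0%N by move: cA; move: #|A| => n; rewrite -M1; lia.
  have := card_cantor_iterate M_gt0 A 1; rewrite (cardD1 x) xX A0 exp0n //.
pose P n k (a b : int) := [/\ (n <= k)%N, coprimez a b,
  exists c, (M ^ k.-1 <= 2 * #|cantor_line A a b k c|)%N &
  exists (D : nat) (c : int), (n.+1 * D <= M ^ k)%N /\
    forall xi : int * int, ((M ^ k)%N%:Z %| xi.1 * b - xi.2 * a - c)%Z ->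
      digits_within M_gt0 B k D xi].
have exP n : exists k a b, (`|a| < 2 * M)%N && (`|b| < 2 * M)%N /\ P n k a b.
  have [K KP] := degree_parameter M_gt1 cA (ltn0Sn n).
  have [d [k_gt0 dk ED eD [dL PL]]] := KP (maxn K n) (leq_maxl _ _).
  set k := maxn K n in k_gt0 dk ED eD dL PL.
  have [z z_prim] := C_prim_root_exists (N_gt0 k).
  have [f fext] := ext k z k_gt0 z_prim.
  have [a [b [co bnd cnt [c cP]]]] :=
    extremizer_line_structure M_gt0 k_gt0 z_prim fext B_proper dk eD dL PL.
  exists k, a, b; split=> //; split=> //; first exact: leq_maxr.
  by exists (d + k * (M * M * d) + M * d)%N, c.
(* the integers between -2 M and 2 M, indexed by a finite type *)
pose dec (i : 'I_(4 * M)) : int := (i : nat)%:Z - (2 * M)%N%:Z.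
have decE (e : int) : (`|e| < 2 * M)%N -> exists i, dec i = e.
  move=> e_lt; have i_lt : (`|(e + (2 * M)%N%:Z)%R| < 4 * M)%N by lia.
  by exists (Ordinal i_lt); rewrite /dec /=; lia.
have [n|[i j] /= ijP] := @infinite_pigeonhole ('I_(4 * M) * 'I_(4 * M))%type
    (fun n ij => exists k, P n k (dec ij.1) (dec ij.2)).
  have [k [a [b [/andP[/decE[i ia] /decE[j jb]] Pn]]]] := exP n.
  by exists (i, j), k; rewrite /= ia jb.
move: (dec i) (dec j) ijP => a b ijP {i j}.
have [_ _ [_ [_ co _ _]]] := ijP 0%N.
have [s [t st]] := Bezoutz a b; rewrite (eqP co) in st.
have [|p pA] := @limit_line R M M_gt0 M_gt1 A a b s t st.
  apply: full_lines_thick; apply: (populous_lines_full M_gt0 M_gt1 st) => n0.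
  have [n le_n [k [nk _ cnt _]]] := ijP n0.
  by exists k => //; apply: leq_trans nk.
(* for B the line is b X - a Y = c, with the sign changed so that its direction
   (a, b) comes out as the perpendicular of (b, -a) *)
have st' : - t * - b + s * a = 1 by rewrite mulrNN addrC.
have [|q qB] := @limit_line R M M_gt0 M_gt1 B (- b) a (- t) s st'.
  move=> E K; have [n le_n [k [nk _ _ [D [c [ED cP]]]]]] := ijP (maxn E K).
  move: le_n; rewrite geq_max => /andP[En Kn].
  exists k, D, (- c); split.
  - exact: leq_trans nk.
  - by apply: leq_trans ED; rewrite leq_mul2r ltnW ?orbT // ltnS.
  - move=> xi xiP; apply: cP; rewrite -rpredN.
    by rewrite [X in (_ %| X)%Z](_ : _ = xi.1 * - b + xi.2 * a - - c) //; ring.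
exists (b%:~R, - a%:~R), p, q; split=> //.
  move=> [/eqP b0 /eqP a0]; rewrite oppr_eq0 !intr_eq0 in a0 b0.
  by move: co; rewrite (eqP a0) (eqP b0).
by rewrite /perp /= opprK; rewrite mulrNz opprK in qB.
Qed.
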